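(* Let $\pi$ be a foliated bivector field on a smooth manifold $M$. \begin{enumerate} \item For every regular point $m\in M$ of $\pi$, there is a neighborhood $\mathcal{U}$ of $m$ and a closed $3$-form $\varphi\in\Omega^3(\mathcal{U})$ such that $(\pi,\varphi)$ is a twisted Poisson structure on $\mathcal{U}$. \item Moreover, if $M$ is oriented, there exists a closed $3$-form $\varphi$ defined on the open subset $\mathcal{U}_{reg}$ of all regular points of $\pi$ such that $(\pi,\varphi)$ is a twisted Poisson structure on $\mathcal{U}_{reg}$. \end{enumerate}
   Context: For a bivector field $\pi$ on $M$, $\pi^\#:T^*M\to TM$ is defined by $\langle \pi^\#(\xi),\eta\rangle=\langle \pi,\xi\wedge\eta\rangle$, and $\wedge^3\pi^\#:\wedge^3T^*M\to\wedge^3TM$ is the induced map. $\pi$ is foliated if $\pi^\#(\Omega^1(M))$ is an integrable distribution, i.e. $[\pi^\#(\Omega^1(M)),\pi^\#(\Omega^1(M))]\subset\pi^\#(\Omega^1(M))$. A point $m$ is a regular point of $\pi$ if the rank of $\pi^\#_{m'}:T^*_{m'}M\to T_{m'}M$ is constant for $m'$ in a neighborhood of $m$. A twisted Poisson structure on a manifold is a pair $(\pi,\phi)$ with $\pi$ a bivector field and $\phi$ a $3$-form such that $\frac12[\pi,\pi]=\wedge^3\pi^\#(\phi)$ (Schouten–Nijenhuis bracket) and $d\phi=0$; on an open subset, $\pi$ denotes the restriction. *)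

(* Defs.v *)
From HB Require Import structures.
From mathcomp Require Import all_boot all_order all_algebra.
From mathcomp Require Import all_classical all_reals all_analysis.

Set Implicit Arguments.
Unset Strict Implicit.
Unset Printing Implicit Defensive.

Import Order.TTheory GRing.Theory Num.Theory.
Import numFieldNormedType.Exports.

Local Open Scope classical_set_scope.
Local Open Scope ring_scope.

(* MathComp world (MathComp-Analysis).

   Manifolds are given by charts, and tensor fields by their components in
   each chart together with the transformation law.  A component in the chart
   c is a function on M that matters only at the points of the domain of c;
   a field on an open subset U is a field whose defining conditions are
   required only at the points of U, so restricting a field to a smaller open
   subset does not change its components.  Indices of the form _ i j ... refer
   to the coordinate frame d/dx_i and coframe dx_i of the chart. *)

(* Partial derivative of f at x with respect to the i-th coordinate. *)
Definition partial (R : realType) (n : nat) (i : 'I_n) (f : 'rV[R]_n -> R)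
    (x : 'rV[R]_n) : R :=
  derive (f : 'rV[R]_n -> R^o) x (delta_mx 0 i).

(* Used only for open V, so that the values of f outside V are irrelevant. *)
Fixpoint Ck_on (R : realType) (n k : nat) (V : set 'rV[R]_n)
    (f : 'rV[R]_n -> R) : Prop :=
  {in V, continuous f} /\
  if k is k'.+1 then
    forall i : 'I_n,
      (forall x, V x -> derivable (f : 'rV[R]_n -> R^o) x (delta_mx 0 i)) /\
      Ck_on k' V (partial i f)
  else True.

Definition smooth_on (R : realType) (n : nat) (V : set 'rV[R]_n)
    (f : 'rV[R]_n -> R) : Prop :=
  forall k, Ck_on k V f.

(* Smooth manifolds of dimension n (Hausdorff, second countable, without
   boundary); chart_inv c is the inverse of the chart c on its image and is
   arbitrary elsewhere. *)
Record smoothManifold (R : realType) (n : nat) := SmoothManifold {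
  carrier :> topologicalType;
  chart_index : Type;
  chart_dom : chart_index -> set carrier;
  chart_map : chart_index -> carrier -> 'rV[R]_n;
  chart_inv : chart_index -> 'rV[R]_n -> carrier;
  manifold_hausdorff : hausdorff_space carrier;
  manifold_second_countable : @second_countable carrier;
  chart_cover : forall m, exists c, chart_dom c m;
  chart_dom_open : forall c, open (chart_dom c);
  chart_image_open : forall c, open (chart_map c @` chart_dom c);
  chart_mapK : forall c, {in chart_dom c, cancel (chart_map c) (chart_inv c)};
  chart_map_continuous : forall c, {in chart_dom c, continuous (chart_map c)};
  chart_inv_continuous :
    forall c, {in chart_map c @` chart_dom c, continuous (chart_inv c)};
  chart_transition_smooth : forall a b (j : 'I_n),
    smooth_on (chart_map a @` (chart_dom a `&` chart_dom b))
      (fun x => chart_map b (chart_inv a x) 0 j)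
}.

Section Fields.
Context (R : realType) (n : nat) (M : smoothManifold R n).

Local Notation I := (chart_index M).

Definition chart_smooth (U : set M) (c : I) (f : M -> R) : Prop :=
  smooth_on (chart_map c @` (U `&` chart_dom c)) (f \o chart_inv c).

(* The function d f / d x_i, for the coordinates x of the chart c. *)
Definition pd (c : I) (i : 'I_n) (f : M -> R) (m : M) : R :=
  partial i (f \o chart_inv c) (chart_map c m).

(* (d y_j / d x_i)_ij for the coordinates x of a and y of b. *)
Definition jac (a b : I) (m : M) : 'M[R]_n :=
  \matrix_(i, j) pd a i (fun p => chart_map b p 0 j) m.

(* Families of components of vector fields, 1-forms, bivector fields,
   trivector fields and 3-forms; they are fields under the conditions below.
   A bivector field is 1/2 \sum_ij pi_ij d/dx_i /\ d/dx_j, a trivector field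
   1/6 \sum_ijk t_ijk d/dx_i /\ d/dx_j /\ d/dx_k, and similarly for forms. *)
Definition vf_components := I -> M -> 'rV[R]_n.
Definition form1_components := I -> M -> 'rV[R]_n.
Definition bivector_components := I -> M -> 'M[R]_n.
Definition trivector_components := I -> M -> 'I_n -> 'I_n -> 'I_n -> R.
Definition form3_components := I -> M -> 'I_n -> 'I_n -> 'I_n -> R.

Definition is_form1 (U : set M) (xi : form1_components) : Prop :=
  [/\ forall c j, chart_smooth U c (fun m => xi c m 0 j)
    & forall a b m, U m -> chart_dom a m -> chart_dom b m ->
        xi a m = xi b m *m (jac a b m)^T].

Definition is_bivector (U : set M) (pi : bivector_components) : Prop :=
  [/\ forall c i j, chart_smooth U c (fun m => pi c m i j),
      forall c m, U m -> chart_dom c m -> (pi c m)^T = - pi c m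
    & forall a b m, U m -> chart_dom a m -> chart_dom b m ->
        pi b m = (jac a b m)^T *m pi a m *m jac a b m].

Definition is_form3 (U : set M) (phi : form3_components) : Prop :=
  [/\ forall c i j k, chart_smooth U c (fun m => phi c m i j k),
      forall c m i j k, U m -> chart_dom c m ->
        phi c m i j k = - phi c m j i k /\ phi c m i j k = - phi c m i k j
    & forall a b m i j k, U m -> chart_dom a m -> chart_dom b m ->
        phi a m i j k = \sum_p \sum_q \sum_r
          jac a b m i p * jac a b m j q * jac a b m k r * phi b m p q r].

Definition lie_bracket (X Y : vf_components) : vf_components :=
  fun c m => \row_j \sum_i (X c m 0 i * pd c i (fun p => Y c p 0 j) m
                            - Y c m 0 i * pd c i (fun p => X c p 0 j) m).

(* pi^#(xi) = \sum_ij xi_i pi_ij d/dx_j, since <pi^#(xi), eta> is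
   <pi, xi /\ eta> = \sum_ij pi_ij xi_i eta_j. *)
Definition sharp (pi : bivector_components) (xi : form1_components) :
    vf_components :=
  fun c m => xi c m *m pi c m.

Definition foliated (pi : bivector_components) : Prop :=
  forall xi eta, is_form1 [set: M] xi -> is_form1 [set: M] eta ->
    exists2 zeta, is_form1 [set: M] zeta &
      forall c m, chart_dom c m ->
        lie_bracket (sharp pi xi) (sharp pi eta) c m = sharp pi zeta c m.

(* In the chart c the matrix of pi^#_m is pi c m. *)
Definition regular (pi : bivector_components) : set M :=
  [set m | exists r : nat, \forall p \near m,
             forall c, chart_dom c p -> \rank (pi c p) = r].

(* Schouten-Nijenhuis bracket of two bivector fields, normalized so that
   [X1 /\ X2, Y1 /\ Y2] is the sum over a, b in {1, 2} of
   (-1)^(a + b) [X_a, Y_b] /\ X_a' /\ Y_b', with {a, a'} = {b, b'} = {1, 2}. *)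
Definition schouten (P Q : bivector_components) : trivector_components :=
  fun c m i j k =>
    let A i j k :=
      \sum_l (P c m k l * pd c l (fun p => Q c p i j) m
              + Q c m k l * pd c l (fun p => P c p i j) m) in
    A i j k + A j k i + A k i j.

Definition wedge3_sharp (pi : bivector_components) (phi : form3_components) :
    trivector_components :=
  fun c m i j k => \sum_p \sum_q \sum_r
    phi c m p q r * pi c m p i * pi c m q j * pi c m r k.

Definition ext_d3 (phi : form3_components) (c : I) (m : M)
    (i j k l : 'I_n) : R :=
  pd c i (fun p => phi c p j k l) m - pd c j (fun p => phi c p i k l) m
  + pd c k (fun p => phi c p i j l) m - pd c l (fun p => phi c p i j k) m.

Definition closed_form3 (U : set M) (phi : form3_components) : Prop :=
  is_form3 U phi /\
  forall c m i j k l, U m -> chart_dom c m -> ext_d3 phi c m i j k l = 0.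

Definition twisted_poisson (U : set M) (pi : bivector_components)
    (phi : form3_components) : Prop :=
  [/\ is_bivector U pi, closed_form3 U phi
    & forall c m i j k, U m -> chart_dom c m ->
        2^-1 * schouten pi pi c m i j k = wedge3_sharp pi phi c m i j k].

(* An orientation of every tangent space, locally constant in each chart:
   o c m tells whether the coordinate frame of c at m is positively
   oriented. *)
Definition is_orientation (o : I -> M -> bool) : Prop :=
  (forall c m, chart_dom c m -> \forall p \near m, o c p = o c m) /\
  (forall a b m, chart_dom a m -> chart_dom b m ->
     (o a m == o b m) = (0 < \det (jac a b m))).

End Fields.

(* Main.v *)
(* The image of [pi^#] is integrable and, near the regular points, of constant
   rank, so its leaves carry the 2-form inverse to [- pi].  A 2-form [w] extends
   this leafwise form as soon as [pi w pi = - pi] (as matrices in a chart).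
   Differentiating this identity, and using that the foliated condition makes
   the trivector [pi, pi] tangent to the leaves, gives
   1/2 [pi, pi] = /\^3 pi^# (d w), and [d w] is closed.  Locally such a [w] is
   - E^T (E pi E^T)^-1 E for a constant matrix [E] that is a left inverse of a
   basis of the column space of [pi] at the point.  The condition
   [pi w pi = - pi] is affine in [w], so a partition of unity yields a global
   [w] on the open set of all regular points, which settles both parts. *)
From HB Require Import structures.
Require Import Defs.
From mathcomp Require Import all_boot all_order all_algebra.
From mathcomp Require Import all_classical all_reals all_analysis.
From mathcomp Require Import ring lra.

Set Implicit Arguments.
Unset Strict Implicit.
Unset Printing Implicit Defensive.

Import Order.TTheory GRing.Theory Num.Theory.
Import numFieldNormedType.Exports.

Local Open Scope classical_set_scope.
Local Open Scope ring_scope.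

(** * Differential calculus in R^n *)

Section Euclidean.
Context (R : realType) (n : nat).
Local Notation V := 'rV[R]_n.
Local Notation e i := (delta_mx 0 i : 'rV[R]_n).

(** The sign of [w] is dictated by the conventions. On a leaf [pi] is invertible, and [w = - pi^-1]
    gives [pi dw pi = d pi], with a plus sign; the opposite choice would produce [- d w]. The
    obstacle is that a degenerate [pi] also has derivatives whose values stick out of its image,
    about which [pi w pi = - pi] says little. It controls [d pi] only after compression by the
    projection [G = - w pi] onto the image. What is lost in each single term is recovered for the
    cyclic sum, which is unchanged by [G] in its last slot because the bracket of two fields
    [pi^# dx_i] lies in the image, and hence in all slots by cyclic symmetry. Cut-off functions
    serve twice. The foliated condition speaks of global 1-forms only, so a coordinate coframe must
    be cut off before the condition can be applied to it. And the objects glued are pairs [(f, f w)]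
    rather than forms [w]: such a pair is defined on all of [M], its conditions survive sums and
    nonnegative smooth multiples, and the division by the total weight takes place once, at the end,
    where that weight is positive. *)

Lemma is_derive_line (f : V -> R^o) (v x : V) (t : R) :
  derivable f (t *: v + x) v ->
  is_derive t (1 : R) (fun s : R => f (s *: v + x) : R^o) ('D_v f (t *: v + x)).
Proof.
have eq_rate : (fun h : R => h^-1 *: (((fun s : R => f (s *: v + x) : R^o)
      \o shift t) (h *: (1 : R)) - f (t *: v + x))) =
    (fun h : R => h^-1 *: ((f \o shift (t *: v + x)) (h *: v)
      - f (t *: v + x))).
  apply/funext => h /=; congr (_ *: (f _ - _)).
  by rewrite [h *: 1]mulr1 scalerDl addrA.
move=> df; split; first by rewrite /derivable eq_rate.
by rewrite /derive eq_rate.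
Qed.

(** Mean value theorem along a segment, with a case for each sign of [s]. This estimate underlies
    both the differentiability of functions with continuous partial derivatives and the symmetry of
    second derivatives. *)
Lemma line_mvt (f : V -> R^o) (v x : V) (L eps s : R) :
  (forall t : R, `|t| <= `|s| -> derivable f (t *: v + x) v /\
     `|'D_v f (t *: v + x) - L| <= eps) ->
  `|f (s *: v + x) - f x - s * L| <= eps * `|s|.
Proof.
move=> H; pose phi (t : R) : R^o := f (t *: v + x).
have dphi (t : R) : `|t| <= `|s| -> is_derive t (1 : R) phi ('D_v f (t *: v + x)).
  by move=> /H[dt _]; exact: is_derive_line.
pose dphi' (t : R) : R := 'D_v f (t *: v + x).
have phi0 : phi 0 = f x by rewrite /phi scale0r add0r.
have cphi a b : (forall t, a <= t <= b -> `|t| <= `|s|) ->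
    {within `[a, b], continuous phi}.
  move=> ab; apply: derivable_within_continuous => t; rewrite in_itv /= => tab.
  by case: (dphi t (ab _ tab)).
suff [c /H[_ cL] E] : exists2 c, `|c| <= `|s| &
    phi s - phi 0 = 'D_v f (c *: v + x) * s.
  rewrite -phi0 -/(phi s) E mulrC -mulrBr normrM mulrC.
  exact: ler_wpM2r.
have [s0|/ltW s0] := leP 0 s.
  have ab t : 0 <= t <= s -> `|t| <= `|s|.
    by move=> /andP[t0 ts]; rewrite !ger0_norm.
  have [|c + E] := @MVT_segment R phi dphi' 0 s s0 _ (cphi _ _ ab).
    move=> t; rewrite in_itv /= => /andP[t0 ts]; apply: dphi.
    by apply: ab; rewrite !ltW.
  rewrite in_itv /= => /ab cs; exists c => //.
  by rewrite E subr0.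
have ab t : s <= t <= 0 -> `|t| <= `|s|.
  by move=> /andP[ts t0]; rewrite !ler0_norm // lerN2.
have [|c + E] := @MVT_segment R phi dphi' s 0 s0 _ (cphi _ _ ab).
  move=> t; rewrite in_itv /= => /andP[t0 ts]; apply: dphi.
  by apply: ab; rewrite !ltW.
rewrite in_itv /= => /ab cs; exists c => //.
by rewrite -opprB E sub0r mulrN opprK.
Qed.

End Euclidean.

Section Differentiability.
Context (R : realType) (n : nat).
Local Notation V := 'rV[R]_n.
Local Notation e i := (delta_mx 0 i : 'rV[R]_n).

Lemma rV_norm_ge (v : V) j : `|v 0 j| <= `|v|.
Proof.
rewrite [leRHS]/Num.norm /= mx_normrE; apply/bigmax_geP; right => /=.
by exists (0, j).
Qed.

Lemma rV_norm_le (v : V) (c : R) :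
  0 <= c -> (forall j, `|v 0 j| <= c) -> `|v| <= c.
Proof.
move=> c0 vc; rewrite [leLHS]/Num.norm /= mx_normrE; apply/bigmax_leP.
by split=> // -[i j] _ /=; rewrite ord1.
Qed.

Lemma C1_differentiable (f : V -> R^o) (x : V) :
  (forall i, \forall y \near x, derivable f y (e i)) ->
  (forall i, {for x, continuous (partial i f)}) -> differentiable f x.
Proof.
move=> df cf; pose D (h : V) : R^o := \sum_i h 0 i * partial i f x.
have D_lin : linear D.
  move=> a u v; rewrite /D scaler_sumr -big_split /=; apply: eq_bigr => i _.
  by rewrite !mxE mulrDl -mulrA.
pose D_linM := GRing.isLinear.Build _ _ _ _ _ D_lin.
pose DL : {linear V -> R^o} := HB.pack D D_linM.
have DL_cont : continuous DL.
  move=> y; apply: (@cvg_big R _ _ _ _ _ _ (nbhs y)) => [|i _].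
    exact: add_continuous.
  by apply: cvgM; [exact: coord_continuous|exact: cvg_cst].
have DLP : f \o shift x = cst (f x) + DL +o_ (0 : V) id.
  apply/eqaddoP => _/posnumP[eps].
  (* The increment [h] is run through in [n] moves parallel to the axes, through the truncations
     [T k h] that keep the first [k] coordinates. Each move costs at most [d * |h|]; dividing by
     [n.+1] instead of [n] covers dimension 0. *)
  pose d := eps%:num / n.+1%:R.
  have d0 : 0 < d by rewrite divr_gt0.
  have Hi i : \forall y \near x, derivable f y (e i) /\
      `|partial i f y - partial i f x| <= d.
    apply: filterI; first exact: df.
    have /cvgrPdist_le/(_ d d0) := cf i.
    by apply: filterS => y; rewrite distrC.
  have /nbhs_ballP[dl /= dl0 H] := filter_forall (nbhs_filter x) Hi.
  pose T k (h : V) : V := \row_j (if (j < k)%N then h 0 j else 0).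
  near=> h.
  have hdl : `|h| < dl.
    near: h; apply/nbhs_ballP; exists dl => // z.
    by rewrite -ball_normE /= sub0r normrN.
  have step k (kn : (k < n)%N) : T k.+1 h = h 0 (Ordinal kn) *: e (Ordinal kn) + T k h.
    apply/rowP => j; rewrite !mxE eqxx /= -val_eqE /= ltnS leq_eqVlt.
    case: eqP => [jk|_] /=; last by rewrite mulr0 add0r.
    by rewrite mulr1 jk ltnn addr0; congr (h 0 _); exact/val_inj.
  have bound k : (k <= n)%N ->
      `|f (T k h + x) - f x - \sum_(i < n | (i < k)%N) h 0 i * partial i f x|
        <= d * k%:R * `|h|.
    elim: k => [_|k IH kn].
      rewrite (_ : T 0 h = 0); last by apply/rowP => j; rewrite !mxE.
      by rewrite add0r subrr sub0r big_pred0 ?oppr0 ?normr0 ?mulr0 ?mul0r.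
    have := IH (ltnW kn); set A := \sum_(i < n | _) _ => {}IH.
    have -> : \sum_(i < n | (i < k.+1)%N) h 0 i * partial i f x =
        h 0 (Ordinal kn) * partial (Ordinal kn) f x + A.
      rewrite (bigD1 (Ordinal kn)) //=; congr (_ + _); apply: eq_bigl => i.
      by rewrite -val_eqE /= ltnS; case: ltngtP.
    rewrite step.
    have L : `|f (h 0 (Ordinal kn) *: e (Ordinal kn) + (T k h + x)) -
        f (T k h + x) - h 0 (Ordinal kn) * partial (Ordinal kn) f x| <=
        d * `|h 0 (Ordinal kn)|.
      apply: line_mvt => t th; rewrite addrA.
      apply: H; rewrite -ball_normE /= opprD addrCA subrr addr0.
      rewrite -normrN opprK (le_lt_trans _ hdl) //; apply: rV_norm_le => // j.
      rewrite !mxE eqxx /= -val_eqE /=; case: eqP => [jk|_].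
        rewrite jk ltnn mulr1 addr0 (le_trans th) //; exact: rV_norm_ge.
      rewrite mulr0 add0r; case: ifP => _; last by rewrite normr0.
      exact: rV_norm_ge.
    have L2 : d * `|h 0 (Ordinal kn)| <= d * `|h|.
      by rewrite ler_wpM2l ?rV_norm_ge // ltW.
    rewrite -natr1 mulrDr mulr1 mulrDl.
    move: L IH; rewrite addrA; move: (f (_ + T k h + x)) (f (T k h + x)).
    move: (_ * partial _ f x) => a u v L IH.
    have -> : u - f x - (a + A) = (u - v - a) + (v - f x - A).
      by rewrite !opprD !addrA; ring.
    rewrite (le_trans (ler_normD _ _)) // addrC lerD //.
    exact: le_trans L2.
  have := bound n (leqnn n).
  rewrite (_ : T n h = h); last by apply/rowP => j; rewrite !mxE ltn_ord.
  rewrite (eq_bigl xpredT) => [|i]; last by rewrite ltn_ord.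
  rewrite /= /cst /= => B; rewrite opprD addrA.
  rewrite (le_trans B) // ler_wpM2r //.
  by rewrite /d -mulrA ler_piMr // mulrC ler_pdivrMr // mul1r ler_nat.
have dE : 'd f x = DL :> (V -> R^o) by apply: diff_unique.
apply/diff_locallyP; rewrite dE; split => //.
Unshelve. all: by end_near. Qed.

End Differentiability.

Lemma near_all (T : topologicalType) (x : T) (P : T -> Prop) :
  (forall y, P y) -> \forall y \near x, P y.
Proof. exact: nearW. Qed.

Lemma near_finall (T : topologicalType) (I : finType) (x : T)
    (P : I -> T -> Prop) :
  (forall i, \forall y \near x, P i y) -> \forall y \near x, forall i, P i y.
Proof. exact: filter_forall. Qed.

(** * Germs of functions of class C^k: algebra, composition, chain rule *)

Section SmoothGerms.
Context (R : realType) (n : nat).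
Local Notation V := 'rV[R]_n.
Local Notation e i := (delta_mx 0 i : 'rV[R]_n).
Implicit Types (f g : V -> R) (x y : V).

(* [f] is of class C^k on some neighborhood of [x]; unlike [Ck_on], this is
   stable under replacing [f] by a function equal to it near [x]. *)
Fixpoint Ck_at (k : nat) (f : V -> R) (x : V) : Prop :=
  (\forall y \near x, {for y, continuous f}) /\
  if k is k'.+1 then
    forall i : 'I_n,
      (\forall y \near x, derivable (f : V -> R^o) y (e i)) /\
      Ck_at k' (partial i f) x
  else True.

Lemma Ck_at_cont k f x : Ck_at k f x -> \forall y \near x, {for y, continuous f}.
Proof. by case: k => [|k] []. Qed.

Lemma Ck_at_near k f x : Ck_at k f x -> \forall y \near x, Ck_at k f y.
Proof.
elim: k f => [|k IH] f /=.
  by move=> [+ _] => /near_join; apply: filterS => y.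
move=> [/near_join cf df]; suff H : \forall y \near x, forall i,
    (\forall z \near y, derivable (f : V -> R^o) z (e i)) /\
    Ck_at k (partial i f) y by apply: filterS2 cf H.
apply: near_finall => i; have [/near_join d /IH s] := df i.
by apply: filterS2 d s.
Qed.

Lemma Ck_onP k (U : set V) f : open U ->
  Ck_on k U f <-> forall x, U x -> Ck_at k f x.
Proof.
move=> Uo; elim: k f => [|k IH] f; split => /=.
- move=> [cf _] x Ux; split => //.
  have := open_nbhs_nbhs (conj Uo Ux); apply: filterS => y Uy.
  by apply: cf; rewrite inE.
- move=> H; split => // x; rewrite inE => /H[/nbhs_singleton cf _]; exact: cf.
- move=> [cf df] x Ux; have nU := open_nbhs_nbhs (conj Uo Ux); split => [|i].
    by apply: filterS nU => y Uy; apply: cf; rewrite inE.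
  have [di si] := df i; split; first by apply: filterS nU => y; exact: di.
  exact: (IH _).1 si _ Ux.
- move=> H; split => [x|i].
    by rewrite inE => /H[/nbhs_singleton cf _]; exact: cf.
  split=> [x /H[_ /(_ i)[/nbhs_singleton]]//|].
  by apply/IH => x /H[_ /(_ i)[]].
Qed.

Lemma partial_near f g x i : (\near x, f x = g x) ->
  partial i f x = partial i g x.
Proof. by move=> fg; apply: near_eq_derive. Qed.

Lemma Ck_at_eq k f g x : (\near x, f x = g x) -> Ck_at k f x -> Ck_at k g x.
Proof.
have cont_eq (u v : V -> R) y : (\near y, u y = v y) ->
    {for y, continuous u} -> {for y, continuous v}.
  move=> uv cu; rewrite /prop_for /continuous_at -(nbhs_singleton uv).
  by apply: cvg_trans cu; exact: (near_eq_cvg uv).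
elim: k f g => [|k IH] f g fg /= [cf df]; split => //.
- by move/near_join: fg cf; apply: filterS2 => y; exact: cont_eq.
- by move/near_join: fg cf; apply: filterS2 => y; exact: cont_eq.
move=> i; have [di si] := df i; split.
  by move/near_join: fg di; apply: filterS2 => y; exact: near_eq_derivable.
apply: IH si; move/near_join: fg; apply: filterS => y; exact: partial_near.
Qed.

Lemma Ck_atW k f x : Ck_at k.+1 f x -> Ck_at k f x.
Proof.
elim: k f => [|k IH] f [cf df]; split => // i.
by have [di /IH] := df i.
Qed.

Lemma partial_cst (c : R) i x : partial i (fun=> c) x = 0.
Proof. exact: (@derive_cst R V R^o c x (e i)). Qed.

Lemma Ck_at_cst k (c : R) x : Ck_at k (fun=> c) x.
Proof.
elim: k c => [|k IH] c; split => //=; do ?by apply: near_all => y; exact: cst_continuous.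
move=> i; split; first by apply: near_all => y; exact: (@derivable_cst R V R^o).
by apply: Ck_at_eq (IH 0); apply: near_all => y; rewrite partial_cst.
Qed.

Lemma partialD f g i x : derivable (f : V -> R^o) x (e i) ->
  derivable (g : V -> R^o) x (e i) ->
  partial i (fun y => f y + g y) x = partial i f x + partial i g x.
Proof. exact: (@deriveD R V R^o). Qed.

Lemma partialM f g i x : derivable (f : V -> R^o) x (e i) ->
  derivable (g : V -> R^o) x (e i) ->
  partial i (fun y => f y * g y) x = f x * partial i g x + g x * partial i f x.
Proof. exact: (@deriveM R V). Qed.

Lemma Ck_atD k f g x : Ck_at k f x -> Ck_at k g x ->
  Ck_at k (fun y => f y + g y) x.
Proof.
elim: k f g => [|k IH] f g [cf df] [cg dg]; split => //.
- by apply: filterS2 cf cg => y; exact: continuousD.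
- by apply: filterS2 cf cg => y; exact: continuousD.
move=> i; have [di si] := df i; have [dj sj] := dg i; split.
  by apply: filterS2 di dj => y; exact: (@derivableD R V R^o).
apply: Ck_at_eq (IH _ _ si sj).
by apply: filterS2 di dj => y fy gy; rewrite partialD.
Qed.

Lemma Ck_atM k f g x : Ck_at k f x -> Ck_at k g x ->
  Ck_at k (fun y => f y * g y) x.
Proof.
elim: k f g => [|k IH] f g Hf Hg; have [cf df] := Hf; have [cg dg] := Hg;
    split => //.
- by apply: filterS2 cf cg => y; exact: continuousM.
- by apply: filterS2 cf cg => y; exact: continuousM.
move=> i; have [di si] := df i; have [dj sj] := dg i; split.
  by apply: filterS2 di dj => y; exact: (@derivableM R V).
apply: Ck_at_eq (Ck_atD (IH _ _ (Ck_atW Hf) sj) (IH _ _ (Ck_atW Hg) si)).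
by apply: filterS2 di dj => y fy gy; rewrite partialM.
Qed.

Lemma Ck_at_inv k f x : Ck_at k f x -> f x != 0 ->
  Ck_at k (fun y => (f y)^-1) x.
Proof.
have near_neq0 (g : V -> R) y : g y != 0 -> {for y, continuous g} ->
    \forall z \near y, g z != 0.
  move=> g0 cg; apply: (cg [set z | z != 0]).
  exact: (open_nbhs_nbhs (conj (@open_neq R 0) g0)).
elim: k f => [|k IH] f Hf f0; have [cf df] := Hf;
  have nf0 := near_neq0 _ _ f0 (nbhs_singleton cf); split => //.
- by apply: filterS2 cf nf0 => y cy fy; exact: continuousV.
- by apply: filterS2 cf nf0 => y cy fy; exact: continuousV.
move=> i; have [di si] := df i; split.
  by apply: filterS2 di nf0 => y dy fy; exact: (@derivableV R V).
have Hi := IH _ (Ck_atW Hf) f0.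
apply: Ck_at_eq (Ck_atM (Ck_at_cst k (-1) x) (Ck_atM (Ck_atM Hi Hi) si)).
apply: filterS2 di nf0 => y dy fy.
by rewrite /partial (@deriveV R V) // scaleNr mulN1r -expr2 exprVn.
Qed.

Lemma is_derive_coord (i j : 'I_n) x :
  is_derive x (e i) (fun y : V => y 0 j : R^o) ((i == j)%:R : R).
Proof.
have @f : {linear V -> R^o}.
  by exists (fun N : V => N 0 j); do 2![eexists]; do ?[constructor];
    rewrite ?mxE// => ? *; rewrite ?mxE//; move=> ?; rewrite !mxE.
have fc : continuous f by exact: coord_continuous.
split; first exact/diff_derivable/(linear_differentiable _ fc).
rewrite (_ : (fun _ => _) = f) // deriveE; last exact: linear_differentiable.
by rewrite diff_lin //= mxE eqxx eq_sym.
Qed.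

Lemma partial_coord (i j : 'I_n) x : partial i (fun y : V => y 0 j) x = (i == j)%:R.
Proof. by case: (is_derive_coord i j x). Qed.

Lemma Ck_at_sum k (I : Type) (r : seq I) (P : pred I) (F : I -> V -> R) x :
  (forall i, P i -> Ck_at k (F i) x) ->
  Ck_at k (fun y => \sum_(i <- r | P i) F i y) x.
Proof.
move=> H; elim: r => [|a r IH].
  by apply: Ck_at_eq (Ck_at_cst k 0 x); apply: near_all => y; rewrite big_nil.
have [Pa|/negPf Pa] := boolP (P a).
  apply: Ck_at_eq (Ck_atD (H _ Pa) IH); apply: near_all => y.
  by rewrite big_cons Pa.
by apply: Ck_at_eq IH; apply: near_all => y; rewrite big_cons Pa.
Qed.

Lemma C1_at_differentiable k f x : Ck_at k.+1 f x ->
  differentiable (f : V -> R^o) x.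
Proof.
move=> [cf df]; apply: C1_differentiable => i; have [di si] := df i => //.
exact: nbhs_singleton (Ck_at_cont si).
Qed.

Lemma row_sum_coord (g : V -> V) :
  g = fun y => \sum_j (g y 0 j *: e j).
Proof. by apply/funext => y; rewrite -row_sum_delta. Qed.

Lemma continuous_coord (g : V -> V) x :
  (forall j, {for x, continuous (fun y => g y 0 j)}) -> {for x, continuous g}.
Proof.
move=> H; rewrite (row_sum_coord g) /prop_for /continuous_at.
apply: (@cvg_big V _ _ _ _ _ _ (nbhs x)) => [|j _]; first exact: add_continuous.
by apply: cvgZr_tmp; exact: H.
Qed.

(** The chain rule fails for functions that merely have partial derivatives, so the proof goes
    through differentials; [C1_differentiable] supplies them for C^1 germs. *)
Lemma partial_comp f (g : V -> V) x i :
  differentiable (f : V -> R^o) (g x) ->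
  (forall j, differentiable (fun y => g y 0 j : R^o) x) ->
  is_derive x (e i) (fun y => f (g y) : R^o)
    (\sum_j partial i (fun y => g y 0 j) x * partial j f (g x)).
Proof.
move=> df dg.
have dgj j : differentiable (fun y => g y 0 j *: e j) x by exact: differentiableZl.
have gE : g = \sum_j (fun y => g y 0 j *: e j).
  by rewrite {1}(row_sum_coord g); apply/funext => y; rewrite fct_sumE.
have dgx : differentiable g x by rewrite gE; exact: differentiable_sum.
split.
  exact/diff_derivable/(@differentiable_comp R V V R^o).
rewrite deriveE; last exact: (@differentiable_comp R V V R^o).
rewrite (@diff_comp R V V R^o) //= -(deriveE _ dgx) gE derive_sum; last first.
  by move=> j; exact: diff_derivable.
rewrite linear_sum; apply: eq_bigr => j _.
have -> : 'D_(e i) (fun y => g y 0 j *: e j) x = partial i (fun y => g y 0 j) x *: e j.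
  rewrite (deriveE (e i) (dgj j)) (diffZl (e j) (dg j)).
  by rewrite -(@deriveE R V R^o _ _ (e i) (dg j)).
rewrite -gE linearZ /partial (@deriveE R V R^o _ _ (e j) df).
by [].
Qed.

Lemma Ck_at_comp k f (g : V -> V) x :
  (forall j, Ck_at k (fun y => g y 0 j) x) -> Ck_at k f (g x) ->
  Ck_at k (fun y => f (g y)) x.
Proof.
elim: k f => [|k IH] f Hg Hf.
  have cg : \forall y \near x, {for y, continuous g}.
    have := near_finall (fun j => Ck_at_cont (Hg j)).
    by apply: filterS => y; exact: continuous_coord.
  split => //; apply: filterS2 cg (nbhs_singleton cg _ (Ck_at_cont Hf)) => y.
  exact: continuous_comp.
have cg : \forall y \near x, {for y, continuous g}.
  have := near_finall (fun j => Ck_at_cont (Hg j)).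
  by apply: filterS => y; exact: continuous_coord.
have ng := nbhs_singleton cg.
have E i : \forall y \near x, is_derive y (e i) (fun y => f (g y) : R^o)
    (\sum_j partial i (fun y => g y 0 j) y * partial j f (g y)).
  have := near_finall (fun j => Ck_at_near (Hg j)).
  have nf : \forall y \near x, Ck_at k.+1 f (g y) := ng _ (Ck_at_near Hf).
  apply: filterS2 nf => y fy gy; apply: partial_comp.
    exact: C1_at_differentiable fy.
  by move=> j; exact: C1_at_differentiable (gy j).
split; first by apply: filterS2 cg (ng _ (Ck_at_cont Hf)) => y; exact: continuous_comp.
move=> i; split; first by apply: filterS (E i) => y [].
have S : Ck_at k (fun y => \sum_j partial i (fun y => g y 0 j) y * partial j f (g y)) x.
  apply: Ck_at_sum => j _; apply: Ck_atM; first by have [_ /(_ i)[]] := Hg j.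
  apply: IH => [l|]; first exact: Ck_atW.
  by have [_ /(_ j)[]] := Hf.
by apply: Ck_at_eq S; apply: filterS (E i) => y [].
Qed.

End SmoothGerms.

(** * Symmetry of second partial derivatives *)

Section Clairaut.
Context (R : realType) (n : nat).
Local Notation V := 'rV[R]_n.
Local Notation e i := (delta_mx 0 i : 'rV[R]_n).

Lemma is_derive_translate (f : V -> R^o) (v a x : V) :
  derivable f (a + x) v ->
  is_derive x v (fun y => f (a + y) : R^o) ('D_v f (a + x)).
Proof.
have eq_rate : (fun h : R => h^-1 *: (((fun y => f (a + y) : R^o) \o shift x)
      (h *: v) - f (a + x))) =
    (fun h : R => h^-1 *: ((f \o shift (a + x)) (h *: v) - f (a + x))).
  by apply/funext => h /=; rewrite addrCA.
move=> df; split; first by rewrite /derivable eq_rate.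
by rewrite /derive eq_rate.
Qed.

(** Two nested uses of [line_mvt]: along [e i] for the difference of [f] and its translate by
    [s *: e j], then along [e j] for [partial i f]. Both moves have length at most [|s|], hence the
    radius [dl / 2]. *)
Lemma second_difference (f : V -> R) (i j : 'I_n) (x : V) (eps : R) :
  Ck_at 2 f x -> 0 < eps ->
  \forall s \near (0 : R),
    `|f (s *: e j + (s *: e i + x)) - f (s *: e i + x) -
      (f (s *: e j + x) - f x) - s * (s * partial j (partial i f) x)|
    <= eps * `|s| * `|s|.
Proof.
move=> [_ /(_ i)[df [_ /(_ j)[dif [cf _]]]]] eps0.
have {}cf := nbhs_singleton cf.
have /cvgrPdist_le/(_ eps eps0) {}cf := cf.
have /nbhs_ballP[dl /= dl0 H] := @filterI _ _ (nbhs_filter x) _ _ cf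
  (@filterI _ _ (nbhs_filter x) _ _ df dif).
have normle (t t' s : R) : `|t| <= `|s| -> `|t'| <= `|s| -> `|s| < dl / 2 ->
    ball x dl (t *: e j + (t' *: e i + x)).
  move=> ts ts' sdl; rewrite -ball_normE /= addrA opprD addrCA subrr addr0.
  have e1 k : `|e k| <= 1.
    apply: rV_norm_le => // l; rewrite mxE; case: (_ && _); by rewrite ?normr1 ?normr0.
  rewrite normrN (le_lt_trans (ler_normD _ _)) // !normrZ.
  rewrite [ltRHS]splitr ltr_leD //.
    by rewrite (le_lt_trans _ sdl) // (le_trans _ ts) // ler_piMr.
  by rewrite (le_trans _ (ltW sdl)) // (le_trans _ ts') // ler_piMr.
apply/nbhs_ballP; exists (dl / 2) => /=; first by rewrite divr_gt0.
move=> s; rewrite -ball_normE /= sub0r normrN => sdl.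
pose F (y : V) : R^o := f (s *: e j + y) - f y.
have -> : f (s *: e j + (s *: e i + x)) - f (s *: e i + x) = F (s *: e i + x) by [].
have -> : f (s *: e j + x) - f x = F x by [].
apply: line_mvt => t ts.
have d1 : is_derive (t *: e i + x) (e i) (fun y => f (s *: e j + y) : R^o)
    (partial i f (s *: e j + (t *: e i + x))).
  apply: is_derive_translate.
  by have [_ []] := H _ (normle s t s (lexx _) ts sdl).
have d2 : is_derive (t *: e i + x) (e i) (f : V -> R^o) (partial i f (t *: e i + x)).
  apply: derivableP.
  have := H _ (normle 0 t s _ ts sdl); rewrite scale0r add0r normr0.
  by move=> /(_ (normr_ge0 _))[_ []].
have [d12 d12E] := is_deriveB d1 d2; split; first exact: d12.
have -> : 'D_(e i) F (t *: e i + x) = partial i f (s *: e j + (t *: e i + x))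
  - partial i f (t *: e i + x) by exact: d12E.
apply: line_mvt => u us.
have [b1 [_ b2]] := H _ (normle u t s us ts sdl).
by split; [exact: b2|rewrite distrC; exact: b1].
Qed.

(** The second difference is symmetric in [i] and [j], so both mixed derivatives approximate the
    same quotient by [s * s], each up to [eps / 2]. *)
Lemma partialC (f : V -> R) (i j : 'I_n) (x : V) : Ck_at 2 f x ->
  partial i (partial j f) x = partial j (partial i f) x.
Proof.
move=> Hf; apply/eqP; rewrite -subr_eq0 -normr_le0; apply/ler_addgt0Pr => eps eps0.
have e2 : 0 < eps / 2 by rewrite divr_gt0.
have /nbhs_ballP[dl /= dl0] := @filterI _ _ (nbhs_filter (0 : R)) _ _
  (second_difference i j Hf e2) (second_difference j i Hf e2).
have s0 : 0 < dl / 2 by rewrite divr_gt0.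
move=> /(_ (dl / 2)); rewrite -ball_normE /= sub0r normrN gtr0_norm //.
rewrite ltr_pdivrMr // ltr_pMr // ltr1n => /(_ isT)[].
rewrite !addrA [dl / 2 *: e j + _]addrC.
move: (f _) (f _) (f _) (f _) (partial j _ x) (partial i _ x) s0.
move: (dl / 2) => s a b c d A B s0 H1 H2.
have : `|s * s * (B - A)| <= eps * (s * s).
  have -> : s * s * (B - A) =
      (d - c - (b - a) - s * (s * A)) - (d - b - (c - a) - s * (s * B)).
    by ring.
  rewrite (le_trans (ler_normB _ _)) // (le_trans (lerD H1 H2)) //.
  by rewrite -mulrDl -mulrDl -splitr mulrA.
rewrite normrM gtr0_norm ?mulr_gt0 // mulrC ler_pM2r ?mulr_gt0 //.
by rewrite add0r.
Qed.

End Clairaut.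

(* The functions [t^-k exp(-1/t)], extended by 0, are closed under
   differentiation, so their smoothness follows by induction on the order. *)
Section Flat.
Context (R : realType).

Definition flat (k : nat) (t : R) : R :=
  if 0 < t then t^-1 ^+ k * expR (- t^-1) else 0.

Lemma flat_le0 k t : t <= 0 -> flat k t = 0.
Proof. by rewrite /flat ltNge => ->. Qed.

Lemma flat_gt0 k t : 0 < t -> 0 < flat k t.
Proof. by move=> t0; rewrite /flat t0 mulr_gt0 ?expR_gt0 // exprn_gt0 ?invr_gt0. Qed.

Lemma flat_ge0 k t : 0 <= flat k t.
Proof. by have [/(flat_le0 k)->//|/(flat_gt0 k)/ltW] := leP t 0. Qed.

(** From [x <= expR x] at [x = 1 / ((k + 1) t)], raised to the power [k + 1]: this gives
    [expR (- 1 / t) <= ((k + 1) t) ^ (k + 1)], one power of [t] more than [t^-k] consumes. *)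
Lemma flat_le_linear k t : flat k t <= k.+1%:R ^+ k.+1 * `|t|.
Proof.
have [t0|t0] := leP t 0; first by rewrite flat_le0 // mulr_ge0 // exprn_ge0.
rewrite /flat t0 gtr0_norm //.
have m0 : 0 < k.+1%:R :> R by [].
have -> : expR (- t^-1) = (expR ((k.+1%:R * t)^-1) ^+ k.+1)^-1.
  by rewrite -expRM_natl invfM mulrA divff ?mul1r ?expRN // gt_eqF.
have mt0 : 0 < k.+1%:R * t by rewrite mulr_gt0.
have le_exp : (k.+1%:R * t)^-1 <= expR ((k.+1%:R * t)^-1).
  by rewrite (le_trans _ (expR_ge1Dx _)) // lerDr.
apply: (@le_trans _ _ (t^-1 ^+ k * (k.+1%:R * t) ^+ k.+1)).
  rewrite ler_pM2l ?exprn_gt0 ?invr_gt0 //.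
  rewrite -[leRHS]invrK lef_pV2 ?posrE ?exprn_gt0 ?expR_gt0 ?invr_gt0 ?exprn_gt0 //.
  by rewrite -exprVn lerXn2r ?nnegrE ?invr_ge0 ?expR_ge0 // ltW.
have E : t^-1 ^+ k * t ^+ k.+1 = t.
  by rewrite exprS mulrCA -exprMn mulVf ?expr1n ?mulr1 ?gt_eqF.
by rewrite exprMn mulrCA E.
Qed.

Lemma is_derive_flat k (t : R) :
  is_derive t (1 : R) (flat k : R -> R^o) (flat k.+2 t - k%:R * flat k.+1 t).
Proof.
have [t0|t0|->] := ltgtP t 0.
- rewrite !flat_le0 ?(ltW t0) // mulr0 subr0.
  refine (@near_eq_is_derive R R R^o (cst 0) (flat k) t 1 0 _ (is_derive_cst _ _ _)).
  have : \forall s \near t, s < 0 by exact: lt_nbhsl.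
  by apply: filterS => s s0; rewrite flat_le0 // ltW.
- have t_neq0 : t != 0 by rewrite gt_eqF.
  apply: (@near_eq_is_derive _ _ _ (fun s : R => s^-1 ^+ k * expR (- s^-1) : R^o)).
    have : \forall s \near t, 0 < s by exact: lt_nbhsr.
    by apply: filterS => s s0; rewrite /flat s0.
  rewrite /flat t0.
  have dV : is_derive t (1 : R) (fun s : R => s^-1 : R^o) (- t^-2).
    have did : derivable (id : R -> R) t (1 : R) by exact: derivable_id.
    split; first exact: (@derivableV R R id t 1 t_neq0 did).
    rewrite (@deriveV R R id t 1 t_neq0 did) derive_id.
    exact: mulr1.
  have dX := @is_deriveX R R _ k _ _ _ dV.
  have dE := @is_derive1_comp R _ _ t _ _ (is_derive_expR (- t^-1)) (is_deriveN dV).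
  have dM := @is_deriveM _ _ _ _ _ _ _ _ dX dE.
  have fE : (fun s : R => s^-1 ^+ k * expR (- s^-1) : R^o) =
      ((fun s : R => s^-1) ^+ k) * (expR \o (- (fun s : R => s^-1))).
    by apply/funext => s; rewrite -[RHS]/((_ ^+ k) s * _) exprfctE.
  rewrite fE; apply: is_derive_eq dM _; rewrite exprfctE /= -exprVn.
  rewrite -![_ *: _]/(_ * _) opprK; case: (k) => [|m]; first by rewrite !expr0; ring.
  by rewrite /= !exprS; ring.
- rewrite !flat_le0 // mulr0 subr0.
  have H : (fun h : R => h^-1 *:
        (((flat k : R -> R^o) \o shift 0) (h *: (1 : R)) - flat k 0))
      @ 0^' --> (0 : R^o).
    apply/cvgrPdist_le => eps eps0.
    have C0 : 0 < k.+2%:R ^+ k.+2 :> R by rewrite exprn_gt0.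
    rewrite near_withinE; apply/nbhs_ballP; exists (eps / k.+2%:R ^+ k.+2) => /=.
      by rewrite divr_gt0.
    move=> h; rewrite -ball_normE /= sub0r normrN ltr_pdivlMr // => he h0.
    rewrite sub0r normrN addr0 (@flat_le0 k 0) // subr0 [h *: 1]mulr1.
    (* The difference quotient of [flat k] at 0 is [flat k.+1], which tends to 0 by the linear
       bound. *)
    rewrite (_ : h^-1 *: flat k h = flat k.+1 h); last first.
      rewrite /flat; case: ifP => _; last exact: mulr0.
      by rewrite exprS -mulrA.
    rewrite ger0_norm ?flat_ge0 // (le_trans (flat_le_linear _ _)) // mulrC ltW //.
  by split; [apply/cvg_ex; exists 0|exact/cvg_lim].
Qed.

Lemma Ck_at_flat n k j (u : 'rV[R]_n -> R) x : Ck_at k u x ->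
  Ck_at k (fun y => flat j (u y)) x.
Proof.
have cflat i : continuous (flat i).
  move=> t; apply: differentiable_continuous; apply/derivable1_diffP.
  by case: (is_derive_flat i t).
elim: k j u => [|k IH] j u Hu.
  split => //; apply: filterS (Ck_at_cont Hu) => y cu.
  by apply: continuous_comp => //; exact: cflat.
split.
  apply: filterS (Ck_at_cont Hu) => y cu.
  by apply: continuous_comp => //; exact: cflat.
move=> i.
have E : \forall y \near x, is_derive y (delta_mx 0 i) (fun y => flat j (u y) : R^o)
    ((flat j.+2 (u y) + - j%:R * flat j.+1 (u y)) * partial i u y).
  apply: filterS (Ck_at_near Hu) => y uy.
  have du := C1_at_differentiable uy.
  have [df dfE] := is_derive_flat j (u y).
  have /derivable1_diffP df' := df.
  have dc : differentiable (fun y => flat j (u y) : R^o) y.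
    exact: (@differentiable_comp R _ R^o R^o).
  split; first exact/diff_derivable.
  rewrite (deriveE _ dc) (@diff_comp R _ R^o R^o) //=.
  rewrite (deriv1E df) derive1E dfE /partial (deriveE _ du) mulNr.
  exact: mulrC.
split; first by apply: filterS E => y [].
have S : Ck_at k
    (fun y => (flat j.+2 (u y) + - j%:R * flat j.+1 (u y)) * partial i u y) x.
  apply: Ck_atM; last by have [_ /(_ i)[]] := Hu.
  apply: Ck_atD; first exact/IH/Ck_atW.
  by apply: Ck_atM; [exact: Ck_at_cst|exact/IH/Ck_atW].
by apply: Ck_at_eq S; apply: filterS E => y [].
Qed.

End Flat.

(** * Smooth functions on a manifold *)

Section SmoothFunctions.
Context (R : realType) (n : nat) (M : smoothManifold R n).
Local Notation I := (chart_index M).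
Implicit Types (f g : M -> R) (m p : M) (a b c : I) (U : set M).

(** Smoothness of the germ at [m], read in every chart around [m]; [smooth_at_chart] shows that one
    chart suffices. *)
Record smooth_at f m : Prop := SmoothAt {
  smooth_atE : forall c, chart_dom c m ->
    forall k, Ck_at k (f \o chart_inv c) (chart_map c m) }.

Lemma near_chart_dom c m : chart_dom c m -> \forall p \near m, chart_dom c p.
Proof. by move=> cm; exact: (open_nbhs_nbhs (conj (chart_dom_open c) cm)). Qed.

Lemma chart_invK c m : chart_dom c m -> chart_inv c (chart_map c m) = m.
Proof. by move=> cm; apply: chart_mapK; rewrite inE. Qed.

Lemma near_chart_map c m (P : 'rV[R]_n -> Prop) : chart_dom c m ->
  (\forall x \near chart_map c m, P x) -> \forall p \near m, P (chart_map c p).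
Proof.
move=> cm; have : {for m, continuous (chart_map c)}.
  by apply: chart_map_continuous; rewrite inE.
exact.
Qed.

Lemma near_chart_inv c m (P : M -> Prop) : chart_dom c m ->
  (\forall p \near m, P p) -> \forall x \near chart_map c m, P (chart_inv c x).
Proof.
move=> cm; have : {for chart_map c m, continuous (chart_inv c)}.
  by apply: chart_inv_continuous; rewrite inE; exists m.
by rewrite /prop_for /continuous_at chart_invK //; exact.
Qed.

Lemma near_chart_image c m : chart_dom c m ->
  \forall x \near chart_map c m, chart_map c (chart_inv c x) = x.
Proof.
move=> cm; have im : (chart_map c @` chart_dom c) (chart_map c m) by exists m.
have := open_nbhs_nbhs (conj (@chart_image_open _ _ M c) im).
by apply: filterS => x [q cq <-]; rewrite chart_invK.
Qed.

Lemma open_chart_image U c : open U -> open (chart_map c @` (U `&` chart_dom c)).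
Proof.
move=> Uo; rewrite openE => _ [p [Up cp] <-].
have nU : \forall q \near p, U q /\ chart_dom c q.
  by apply: filterI; [exact: open_nbhs_nbhs|exact: near_chart_dom].
have := near_chart_inv cp nU; apply: filterS2 (near_chart_image cp) => x E [Ux cx].
by exists (chart_inv c x).
Qed.

Lemma chart_smoothP U c f : open U -> chart_smooth U c f <->
  (forall m, U m -> chart_dom c m ->
   forall k, Ck_at k (f \o chart_inv c) (chart_map c m)).
Proof.
move=> Uo; have Io := @open_chart_image U c Uo; split.
  by move=> H m Um cm k; apply: (Ck_onP k _ Io).1 (H k) _ _; exists m.
by move=> H k; apply/(Ck_onP k _ Io) => _ [m [Um cm] <-]; exact: H.
Qed.

Lemma near_chart_changeE a b m : chart_dom a m -> chart_dom b m ->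
  \forall x \near chart_map b m,
    chart_inv a (chart_map a (chart_inv b x)) = chart_inv b x.
Proof.
move=> am bm; have := near_chart_inv bm (near_chart_dom am).
by apply: filterS => x /chart_invK.
Qed.

Lemma smooth_transition a b m j k : chart_dom a m -> chart_dom b m ->
  Ck_at k (fun x => chart_map b (chart_inv a x) 0 j) (chart_map a m).
Proof.
move=> am bm; have Io : open (chart_map a @` (chart_dom a `&` chart_dom b)).
  by rewrite setIC; apply: open_chart_image; exact: chart_dom_open.
by apply: (Ck_onP k _ Io).1 (chart_transition_smooth a b j k) _ _; exists m.
Qed.

Lemma smooth_at_chart a f m : chart_dom a m ->
  (forall k, Ck_at k (f \o chart_inv a) (chart_map a m)) -> smooth_at f m.
Proof.
move=> am fa; split => b bm k.
have H : Ck_at k (fun x => (f \o chart_inv a) (chart_map a (chart_inv b x)))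
    (chart_map b m).
  apply: (@Ck_at_comp _ _ k _ (fun x => chart_map a (chart_inv b x))).
    by move=> j; exact: smooth_transition.
  by rewrite chart_invK.
apply: Ck_at_eq H; apply: filterS (near_chart_changeE am bm) => x /= -> //.
Qed.

Lemma smooth_at_of_chart_smooth U c f m : open U -> chart_smooth U c f ->
  U m -> chart_dom c m -> smooth_at f m.
Proof.
by move=> Uo /(chart_smoothP c f Uo) H Um cm; exact: (smooth_at_chart cm (H _ Um cm)).
Qed.

Lemma chart_smooth_of_smooth_at U c f : open U ->
  (forall m, U m -> chart_dom c m -> smooth_at f m) -> chart_smooth U c f.
Proof.
by move=> Uo H; apply/chart_smoothP => // m Um cm k;
  exact: (smooth_atE (H m Um cm)).
Qed.

Lemma smooth_at_eq f g m : (\forall p \near m, f p = g p) ->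
  smooth_at f m -> smooth_at g m.
Proof.
move=> fg H; split=> c cm k; apply: Ck_at_eq (smooth_atE H cm k).
exact: near_chart_inv fg.
Qed.

Lemma smooth_at_cst (x : R) m : smooth_at (fun=> x) m.
Proof. by split=> c cm k; exact: Ck_at_cst. Qed.

Lemma smooth_atD f g m : smooth_at f m -> smooth_at g m ->
  smooth_at (fun p => f p + g p) m.
Proof. by move=> [Hf] [Hg]; split=> c cm k; apply: Ck_atD; [exact: Hf|exact: Hg]. Qed.

Lemma smooth_atM f g m : smooth_at f m -> smooth_at g m ->
  smooth_at (fun p => f p * g p) m.
Proof. by move=> [Hf] [Hg]; split=> c cm k; apply: Ck_atM; [exact: Hf|exact: Hg]. Qed.

Lemma smooth_atN f m : smooth_at f m -> smooth_at (fun p => - f p) m.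
Proof.
move=> Hf; apply: smooth_at_eq (smooth_atM (smooth_at_cst (-1) m) Hf).
by apply: near_all => p; rewrite mulN1r.
Qed.

Lemma smooth_at_inv f m : smooth_at f m -> f m != 0 ->
  smooth_at (fun p => (f p)^-1) m.
Proof.
by move=> [Hf] f0; split=> c cm k; apply: Ck_at_inv; [exact: Hf|rewrite /= chart_invK].
Qed.

Lemma smooth_at_flat f m : smooth_at f m -> smooth_at (fun p => flat 0 (f p)) m.
Proof. by move=> [Hf]; split=> c cm k; apply: Ck_at_flat; exact: Hf. Qed.

Lemma smooth_at_sum (J : Type) (r : seq J) (P : pred J) (F : J -> M -> R) m :
  (forall j, P j -> smooth_at (F j) m) ->
  smooth_at (fun p => \sum_(j <- r | P j) F j p) m.
Proof.
move=> H; elim: r => [|j r IH].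
  by apply: smooth_at_eq (smooth_at_cst 0 m); apply: near_all => y; rewrite big_nil.
have [Pj|/negPf Pj] := boolP (P j).
  apply: smooth_at_eq (smooth_atD (H _ Pj) IH); apply: near_all => y.
  by rewrite big_cons Pj.
by apply: smooth_at_eq IH; apply: near_all => y; rewrite big_cons Pj.
Qed.

Lemma smooth_at_prod (J : Type) (r : seq J) (P : pred J) (F : J -> M -> R) m :
  (forall j, P j -> smooth_at (F j) m) ->
  smooth_at (fun p => \prod_(j <- r | P j) F j p) m.
Proof.
move=> H; elim: r => [|j r IH].
  by apply: smooth_at_eq (smooth_at_cst 1 m); apply: near_all => y; rewrite big_nil.
have [Pj|/negPf Pj] := boolP (P j).
  apply: smooth_at_eq (smooth_atM (H _ Pj) IH); apply: near_all => y.
  by rewrite big_cons Pj.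
by apply: smooth_at_eq IH; apply: near_all => y; rewrite big_cons Pj.
Qed.

Lemma smooth_at_coord c m (j : 'I_n) : chart_dom c m ->
  smooth_at (fun p => chart_map c p 0 j) m.
Proof. by move=> cm; split=> b bm k; exact: smooth_transition. Qed.

Lemma smooth_at_pd c i f m : chart_dom c m -> smooth_at f m ->
  smooth_at (pd c i f) m.
Proof.
move=> cm Hf; apply: (smooth_at_chart cm) => k.
have [_ /(_ i)[_ H]] := smooth_atE Hf cm k.+1; apply: Ck_at_eq H.
by apply: filterS (near_chart_image cm) => x /= E; rewrite /pd E.
Qed.

Lemma smooth_at_cont f m : smooth_at f m -> {for m, continuous f}.
Proof.
move=> Hf; have [c cm] := chart_cover m.
have cf := nbhs_singleton (Ck_at_cont (smooth_atE Hf cm 0)).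
move=> A fA; have := cf A; rewrite /= chart_invK // => /(_ fA) H.
have := near_chart_map cm H; apply: filterS2 (near_chart_dom cm) => p cp /=.
by rewrite chart_invK.
Qed.

Lemma smooth_at_neq0 f m : smooth_at f m -> f m != 0 ->
  \forall p \near m, f p != 0.
Proof.
move=> Hf f0; have cf : f @ m --> f m := smooth_at_cont Hf.
exact: cf _ (open_nbhs_nbhs (conj (@open_neq R 0) f0)).
Qed.

Lemma smooth_at_gt f m (x : R) : smooth_at f m -> x < f m ->
  \forall p \near m, x < f p.
Proof.
move=> Hf xf; have cf : f @ m --> f m := smooth_at_cont Hf.
exact: cf _ (open_nbhs_nbhs (conj (@open_gt R x) xf)).
Qed.

Lemma pd_eq c i f g m : chart_dom c m -> (\forall p \near m, f p = g p) ->
  pd c i f m = pd c i g m.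
Proof. by move=> cm fg; apply: partial_near; exact: near_chart_inv fg. Qed.

Lemma smooth_derivable c i f m : chart_dom c m -> smooth_at f m ->
  derivable (f \o chart_inv c : 'rV[R]_n -> R^o) (chart_map c m) (delta_mx 0 i).
Proof.
by move=> cm Hf; have [_ /(_ i)[/nbhs_singleton]] := smooth_atE Hf cm 1.
Qed.

Lemma pd_cst c i (x : R) m : pd c i (fun=> x) m = 0.
Proof. exact: partial_cst. Qed.

Lemma pdD c i f g m : chart_dom c m -> smooth_at f m -> smooth_at g m ->
  pd c i (fun p => f p + g p) m = pd c i f m + pd c i g m.
Proof.
by move=> cm Hf Hg; apply: (@partialD _ _ (f \o chart_inv c) (g \o chart_inv c));
  exact: smooth_derivable.
Qed.

Lemma pdM c i f g m : chart_dom c m -> smooth_at f m -> smooth_at g m ->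
  pd c i (fun p => f p * g p) m = pd c i f m * g m + f m * pd c i g m.
Proof.
move=> cm Hf Hg; have := @partialM _ _ (f \o chart_inv c) (g \o chart_inv c) i
  (chart_map c m) (smooth_derivable cm Hf) (smooth_derivable cm Hg).
by rewrite /= chart_invK // addrC [g m * _]mulrC.
Qed.

Lemma pdN c i f m : chart_dom c m -> smooth_at f m ->
  pd c i (fun p => - f p) m = - pd c i f m.
Proof.
move=> cm Hf; rewrite (@pd_eq c i _ (fun p => -1 * f p)) //; last first.
  by apply: near_all => p; rewrite mulN1r.
rewrite pdM //; last exact: smooth_at_cst.
by rewrite pd_cst mul0r add0r mulN1r.
Qed.

Lemma pd_sum c i (J : Type) (r : seq J) (F : J -> M -> R) m :
  chart_dom c m -> (forall j, smooth_at (F j) m) ->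
  pd c i (fun p => \sum_(j <- r) F j p) m = \sum_(j <- r) pd c i (F j) m.
Proof.
move=> cm H; elim: r => [|j r IH].
  rewrite [RHS]big_nil -[RHS](pd_cst c i 0 m); apply: pd_eq => //.
  by apply: near_all => y; rewrite big_nil.
rewrite big_cons -IH -pdD //; last exact: smooth_at_sum.
by apply: pd_eq => //; apply: near_all => y; rewrite big_cons.
Qed.

Lemma pdC c i j f m : chart_dom c m -> smooth_at f m ->
  pd c i (pd c j f) m = pd c j (pd c i f) m.
Proof.
move=> cm Hf.
have E k l : pd c k (pd c l f) m =
    partial k (partial l (f \o chart_inv c)) (chart_map c m).
  apply: partial_near; apply: filterS (near_chart_image cm) => x /= Ex.
  by rewrite /pd Ex.
by rewrite !E; apply: partialC; exact: smooth_atE.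
Qed.

Lemma pd_chain a b i f m : chart_dom a m -> chart_dom b m -> smooth_at f m ->
  pd a i f m = \sum_j jac a b m i j * pd b j f m.
Proof.
move=> am bm Hf; rewrite /pd.
have -> : partial i (f \o chart_inv a) (chart_map a m) =
    partial i (fun x => (f \o chart_inv b) (chart_map b (chart_inv a x))) (chart_map a m).
  by apply: partial_near; apply: filterS (near_chart_changeE bm am) => x /= ->.
have [||_ E] := @partial_comp _ _ (f \o chart_inv b)
    (fun x => chart_map b (chart_inv a x)) (chart_map a m) i.
- by rewrite chart_invK //; exact: C1_at_differentiable (smooth_atE Hf bm 1).
- by move=> j; exact: C1_at_differentiable (smooth_transition j 1%N am bm).
by rewrite {1}/partial E; apply: eq_bigr => j _; rewrite mxE chart_invK.
Qed.

Lemma smooth_at_jac a b m i j : chart_dom a m -> chart_dom b m ->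
  smooth_at (fun p => jac a b p i j) m.
Proof.
move=> am bm; apply: (@smooth_at_eq (pd a i (fun p => chart_map b p 0 j))).
  by apply: near_all => p; rewrite mxE.
by apply: smooth_at_pd am _; exact: smooth_at_coord.
Qed.

Lemma jac_comp a b c m : chart_dom a m -> chart_dom b m -> chart_dom c m ->
  jac a c m = jac a b m *m jac b c m.
Proof.
move=> am bm cm; apply/matrixP => i j; rewrite !mxE (pd_chain _ am bm).
  by apply: eq_bigr => k _; rewrite !mxE.
exact: smooth_at_coord.
Qed.

Lemma jac_id a m : chart_dom a m -> jac a a m = 1%:M.
Proof.
move=> am; apply/matrixP => i j; rewrite !mxE -(partial_coord i j (chart_map a m)).
by apply: partial_near; apply: filterS (near_chart_image am) => x /= ->.
Qed.

(** Second derivatives of a change of coordinates are symmetric. This cancels the non-tensorial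
    terms when [ext_d2] is transported between charts. *)
Lemma pd_jacC a b m i j k : chart_dom a m -> chart_dom b m ->
  pd a i (fun p => jac a b p j k) m = pd a j (fun p => jac a b p i k) m.
Proof.
move=> am bm.
have E x y : pd a x (fun p => jac a b p y k) m =
    pd a x (pd a y (fun p => chart_map b p 0 k)) m.
  by apply: pd_eq => //; apply: near_all => p; rewrite mxE.
rewrite (E i j) (E j i); apply: pdC => //; exact: smooth_at_coord.
Qed.

End SmoothFunctions.

(** * Bump functions *)

Section Bump.
Context (R : realType) (n : nat) (M : smoothManifold R n).
Implicit Types (f g : M -> R) (m p : M) (W : set M).

(** The last condition says that the closed support of [f] lies in [W], so that products of [f] with
    functions smooth on [W] extend smoothly by 0. *)
Definition bump_on W f : Prop :=
  [/\ forall p, smooth_at f p, forall p, 0 <= f p &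
      forall p, ~ W p -> \forall q \near p, f q = 0].

(** A product over the coordinates of [flat 0 (r^2 - (x_j - x0_j)^2)] is positive inside a cube and
    vanishes outside it; it is extended by 0 beyond the chart. *)
Lemma exists_bump W m : open W -> W m -> exists2 f, bump_on W f & 0 < f m.
Proof.
move=> Wo Wm; have [c cm] := chart_cover m.
pose x0 := chart_map c m.
have /nbhs_ballP[dl /= dl0 ball_im] :
    nbhs x0 (chart_map c @` (W `&` chart_dom c)).
  by apply: open_nbhs_nbhs; split; [exact: open_chart_image|exists m].
pose r := dl / 2; have r0 : 0 < r by rewrite divr_gt0.
pose cube := [set x : 'rV[R]_n | forall j, [set` `[x0 0 j - r, x0 0 j + r]] (x 0 j)].
have cubeP (x : 'rV[R]_n) : (forall j, `|x 0 j - x0 0 j| <= r) -> cube x.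
  by move=> H j; rewrite /= in_itv /= -ler_distl.
have cube_im x : cube x -> (chart_map c @` (W `&` chart_dom c)) x.
  move=> cx; apply: ball_im; rewrite -ball_normE /= distrC.
  apply: (@le_lt_trans _ _ r); last by rewrite /r ltr_pdivrMr // ltr_pMr // ltr1n.
  apply: rV_norm_le; first exact: ltW.
  by move=> j; rewrite !mxE ler_distl; have := cx j; rewrite /= in_itv.
pose K := chart_inv c @` cube.
have K_sub p : K p -> W p /\ chart_dom c p.
  by case=> x /cube_im[q [Wq cq] <-] <-; rewrite chart_invK.
(* A set closed in the chart need not be closed in [M]. The image of the cube is compact, and the
   Hausdorff property makes it closed; hence the extension by 0 is smooth also at the frontier of
   the chart domain. *)
have K_closed : closed K.
  apply: compact_closed; first exact: manifold_hausdorff.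
  apply: continuous_compact.
    apply: continuous_in_subspaceT => x; rewrite inE => /cube_im[q [_ cq] qx].
    by apply: chart_inv_continuous; rewrite inE; exists q.
  exact: (@rV_compact R n (fun j => [set` `[x0 0 j - r, x0 0 j + r]])
    (fun j => @segment_compact R _ _)).
pose b p : R := \prod_j flat 0 (r ^+ 2 - (chart_map c p 0 j - x0 0 j) ^+ 2).
have b_smooth p : chart_dom c p -> smooth_at b p.
  move=> cp; apply: smooth_at_prod => j _; apply: smooth_at_flat.
  apply: smooth_atD; first exact: smooth_at_cst.
  apply: smooth_atN; have H : smooth_at (fun q => chart_map c q 0 j - x0 0 j) p.
    by apply: smooth_atD; [exact: smooth_at_coord|exact: smooth_at_cst].
  exact: (smooth_atM H H).
have b_ge0 p : 0 <= b p by apply: prodr_ge0 => j _; exact: flat_ge0.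
pose f p : R := if `[< chart_dom c p >] then b p else 0.
have f0 p : ~ K p -> f p = 0.
  move=> Kp; rewrite /f; case: asboolP => // cp; apply: contrapT => bp; apply: Kp.
  exists (chart_map c p); last exact: chart_invK.
  apply: cubeP => j; rewrite leNgt; apply/negP => rj; apply: bp.
  rewrite /b (bigD1 j) //= flat_le0 ?mul0r // subr_le0 -[leRHS]real_normK ?num_real //.
  by rewrite lerXn2r ?nnegrE ?normr_ge0 ?ltW.
have nf0 p : ~ K p -> \forall q \near p, f q = 0.
  move=> Kp; have : \forall q \near p, ~ K q.
    by apply: open_nbhs_nbhs; split=> //; exact: closed_openC.
  by apply: filterS => q; exact: f0.
exists f; last first.
  rewrite /f asboolT // prodr_gt0 // => j _.
  by rewrite flat_gt0 // subrr expr0n subr0 exprn_gt0.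
split => [p|p|p Wp].
- have [/K_sub[_ cp]|/nf0 fp] := EM (K p); last first.
    by apply: smooth_at_eq (smooth_at_cst 0 p); apply: filterS fp => q.
  apply: smooth_at_eq (b_smooth p cp); apply: filterS (near_chart_dom cp) => q cq.
  by rewrite /f asboolT.
- by rewrite /f; case: ifP.
- by apply: nf0 => /K_sub[].
Qed.

Lemma bump_on_eq0 W f p : bump_on W f -> ~ W p -> f p = 0.
Proof. by move=> [_ _ H] /H/nbhs_singleton. Qed.

Lemma smooth_at_bumpM W f g p : bump_on W f ->
  (W p -> smooth_at g p) -> smooth_at (fun q => f q * g q) p.
Proof.
move=> [fs _ f0] gs; have [/gs|/f0 fp] := EM (W p); first exact: smooth_atM.
apply: smooth_at_eq (smooth_at_cst 0 p); apply: filterS fp => q ->.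
by rewrite mul0r.
Qed.

End Bump.

(** * The foliated condition at a point *)

Section Foliated.
Context (R : realType) (n : nat) (M : smoothManifold R n).
Variable pi : bivector_components M.
Hypotheses (pi_bivector : is_bivector setT pi) (pi_foliated : foliated pi).

Lemma smooth_at_bivector c i j m : chart_dom c m ->
  smooth_at (fun p => pi c p i j) m.
Proof.
move=> cm; case: pi_bivector => H _ _.
exact: smooth_at_of_chart_smooth openT (H c i j) I cm.
Qed.

(** With [X_i = pi^# dx_i], this says that [[X_i, X_j]] lies in the image of [pi^#] at [m]: the only
    form in which integrability is used later. *)
Lemma foliated_bracket c m i j : chart_dom c m -> exists z : 'rV[R]_n, forall k,
  \sum_l (pi c m i l * pd c l (fun p => pi c p j k) m
          - pi c m j l * pd c l (fun p => pi c p i k) m) = (z *m pi c m) 0 k.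
Proof.
move=> cm; have [f fb fm] := exists_bump (chart_dom_open c) cm.
(* The 1-form [f dx_i0]: the terms in the derivatives of [f] of the bracket lie
   in the image of [pi^#], so [f] need not be constant near [m]. *)
pose xi i0 : form1_components M := fun b p => \row_q (f p * jac b c p q i0).
have xiE i0 b p q : xi i0 b p 0 q = f p * jac b c p q i0 by rewrite [LHS]mxE.
have xi_form i0 : is_form1 setT (xi i0).
  split=> [b q|a b p _ ap bp].
    apply: chart_smooth_of_smooth_at openT _ => p _ bp.
    apply: (@smooth_at_eq _ _ _ (fun p => f p * jac b c p q i0)).
      by apply: near_all => q'; rewrite xiE.
    by apply: smooth_at_bumpM fb _ => cp; exact: smooth_at_jac.
  apply/rowP => q; rewrite xiE [RHS]mxE; have [cp|cp] := EM (chart_dom c p).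
    rewrite (jac_comp ap bp cp) [X in _ * X]mxE mulr_sumr; apply: eq_bigr => s _.
    by rewrite xiE [_^T _ _]mxE -mulrA [jac a b p q s * _]mulrC.
  rewrite (bump_on_eq0 fb cp) mul0r big1 // => s _.
  by rewrite xiE (bump_on_eq0 fb cp) !mul0r.
have sharp_xi i0 p k : chart_dom c p -> sharp pi (xi i0) c p 0 k = f p * pi c p i0 k.
  move=> cp; rewrite /sharp [LHS]mxE (bigD1 i0) //= big1 => [|s si].
    by rewrite xiE jac_id // mxE eqxx mulr1 addr0.
  by rewrite xiE jac_id // mxE (negPf si) mulr0 mul0r.
have pd_xi i0 k l : pd c l (fun p => sharp pi (xi i0) c p 0 k) m =
    pd c l f m * pi c m i0 k + f m * pd c l (fun p => pi c p i0 k) m.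
  rewrite -pdM //; last 2 first.
  - by case: fb.
  - exact: smooth_at_bivector.
  by apply: pd_eq => //; apply: filterS (near_chart_dom cm) => p; exact: sharp_xi.
have [zeta _ /(_ c m cm) E] := pi_foliated (xi_form i) (xi_form j).
pose al i0 := \sum_l f m * pi c m i0 l * pd c l f m.
(* Solves [[f X_i, f X_j] = f^2 [X_i, X_j] + f X_i(f) X_j - f X_j(f) X_i] for [[X_i, X_j]]. Here
   [al i] is [f X_i(f)], and [X_j] is the image of the basis covector [delta_mx 0 j]. *)
exists ((f m)^-2 *: (zeta c m - al i *: delta_mx 0 j + al j *: delta_mx 0 i)) => k.
have {E} : lie_bracket (sharp pi (xi i)) (sharp pi (xi j)) c m 0 k =
  (zeta c m *m pi c m) 0 k by rewrite E.
have f_neq0 : f m != 0 by rewrite gt_eqF.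
rewrite -scalemxAl mulmxDl mulmxBl -!scalemxAl -!rowE.
have ZE (z : 'rV[R]_n) x y w :
    (x *: (z - y *: row j (pi c m) + w *: row i (pi c m))) 0 k =
    x * (z 0 k - y * pi c m j k + w * pi c m i k) by rewrite !mxE.
rewrite ZE => <-; rewrite [lie_bracket _ _ _ _ _ _]mxE.
apply: (mulfI (expf_neq0 2 f_neq0)).
rewrite mulrA mulfV ?expf_neq0 // mul1r mulr_sumr /al !mulr_suml -sumrB -big_split /=.
apply: eq_bigr => l _; rewrite !sharp_xi // !pd_xi; ring.
Qed.

End Foliated.

(** * The pointwise identity *)

Section TrilinearAlgebra.
Context (R : realFieldType) (n : nat).
Local Notation tensor3 := ('I_n -> 'I_n -> 'I_n -> R).

Lemma skew_mxE (A : 'M[R]_n) i j : A^T = - A -> A i j = - A j i.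
Proof. by move=> /matrixP/(_ j i); rewrite !mxE. Qed.

(** One formula for three uses: [wedge3_sharp] when [G] is [pi], the change of chart of a 3-form
    when [G] is a transposed Jacobian, and the projection of all slots in [half_schouten_eq]. *)
Definition tri (F : tensor3) (G : 'M[R]_n) (i j k : 'I_n) : R :=
  \sum_p \sum_q \sum_r F p q r * G p i * G q j * G r k.

Definition cyclic_sum (F : tensor3) (i j k : 'I_n) : R :=
  F i j k + F j k i + F k i j.

Lemma tri_rot (F : tensor3) G i j k :
  tri (fun p q r => F q r p) G i j k = tri F G j k i.
Proof.
rewrite /tri exchange_big; apply: eq_bigr => q _ /=.
rewrite exchange_big; apply: eq_bigr => r _ /=.
by apply: eq_bigr => p _; ring.
Qed.

Lemma tri_cyclic (F : tensor3) G i j k :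
  tri (cyclic_sum F) G i j k = cyclic_sum (tri F G) i j k.
Proof.
rewrite /cyclic_sum -(tri_rot F G i j k).
have -> : tri F G k i j = tri (fun p q r => F r p q) G i j k.
  by rewrite -(tri_rot F) -(tri_rot (fun p q r => F q r p)).
rewrite /tri -!big_split /=; apply: eq_bigr => p _.
rewrite -!big_split /=; apply: eq_bigr => q _.
rewrite -!big_split /=; apply: eq_bigr => r _; ring.
Qed.

Lemma tri_mulmx (S : 'I_n -> 'M[R]_n) G i j k :
  tri (fun p q r => S r p q) G i j k =
  (\sum_r G r k *: (G^T *m S r *m G)) i j.
Proof.
rewrite summxE /tri; under eq_bigr do rewrite exchange_big /=.
rewrite exchange_big /=; apply: eq_bigr => r _.
rewrite !mxE mulr_sumr exchange_big; apply: eq_bigr => q _ /=.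
rewrite !mxE !mulr_suml mulr_sumr; apply: eq_bigr => p _.
by rewrite !mxE; ring.
Qed.

(** Cyclic symmetry brings each slot in turn to the last position, where [G] acts trivially. *)
Lemma tri_of_slot3 (T : tensor3) (G : 'M[R]_n) :
  (forall i j k, T i j k = T j k i) ->
  (forall i j k, \sum_c T i j c * G c k = T i j k) ->
  forall i j k, tri T G i j k = T i j k.
Proof.
move=> Trot Tslot i j k; rewrite /tri.
transitivity (\sum_r (\sum_q (\sum_p T q r p * G p i) * G q j) * G r k).
  under eq_bigr do rewrite exchange_big /=.
  rewrite exchange_big /=; apply: eq_bigr => r _.
  rewrite mulr_suml exchange_big /=; apply: eq_bigr => q _.
  by rewrite !mulr_suml; apply: eq_bigr => p _; rewrite (Trot p q r).
have E1 q r : \sum_p T q r p * G p i = T r i q by rewrite Tslot Trot.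
have E2 r : \sum_q T r i q * G q j = T i j r by rewrite Tslot Trot.
rewrite -[RHS]Tslot; apply: eq_bigr => r _; congr (_ * _).
by rewrite -E2; apply: eq_bigr => q _; rewrite E1.
Qed.

Variables (P W : 'M[R]_n) (dP dW : 'I_n -> 'M[R]_n).
Hypotheses (P_skew : P^T = - P) (dP_skew : forall l, (dP l)^T = - dP l)
  (W_skew : W^T = - W) (PWP : P *m W *m P = - P)
  (dPWP : forall l, dP l *m W *m P + P *m dW l *m P + P *m W *m dP l = - dP l).
Hypothesis bracket_in_image : forall i j, exists z : 'rV[R]_n, forall k,
  \sum_l (P i l * dP l j k - P j l * dP l i k) = (z *m P) 0 k.

Lemma half_schouten_eq i j k :
  cyclic_sum (fun i j k => \sum_l P k l * dP l i j) i j k =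
  tri (cyclic_sum (fun p q r => dW r p q)) P i j k.
Proof.
(* [G] is the projection onto the image of [pi^#]: both sides are invariant under
   [G] in every slot, and the terms of [P dW P] then collapse. *)
pose G := - (W *m P); pose S k := \sum_l P k l *: dP l.
have PG : P *m G = P by rewrite mulmxN mulmxA PWP opprK.
have GtE : G^T = - (P *m W).
  by rewrite /G linearN /= trmx_mul P_skew W_skew mulmxN mulNmx opprK.
have GtP : G^T *m P = P by rewrite GtE mulNmx PWP opprK.
have GG : G *m G = G by rewrite {1}/G mulNmx -mulmxA PG.
have GtGt : G^T *m G^T = G^T by rewrite -trmx_mul GG.
(* The index [k] of [S k] enters only through [P k l], and [G^T P = P]. *)
have S_slot k' : \sum_c G c k' *: S c = S k'.
  rewrite /S; under eq_bigr do rewrite scaler_sumr.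
  rewrite exchange_big; apply: eq_bigr => l _ /=.
  under eq_bigr do rewrite scalerA.
  rewrite -scaler_suml; congr (_ *: _); rewrite -[in RHS]GtP mxE.
  by apply: eq_bigr => c _; rewrite [G^T _ _]mxE.
have SE : (fun i j k => \sum_l P k l * dP l i j) = (fun i j k => S k i j) :> tensor3.
  apply/funext => a; apply/funext => b; apply/funext => c.
  by rewrite summxE; apply: eq_bigr => l _; rewrite mxE.
rewrite SE tri_cyclic; set F : tensor3 := fun i j k => S k i j.
have projF a b c : tri F G a b c = tri (fun p q r => dW r p q) P a b c.
  rewrite !tri_mulmx.
  have -> : \sum_r G r c *: (G^T *m S r *m G) = G^T *m S c *m G.
    rewrite -[in RHS](S_slot c) mulmx_sumr mulmx_suml; apply: eq_bigr => r _.
    by rewrite -scalemxAr -scalemxAl.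
  congr (fun_of_matrix _ a b); rewrite /S mulmx_sumr mulmx_suml; apply: eq_bigr => r _.
  rewrite -scalemxAr -scalemxAl.
  have -> : P r c = - P c r by exact: skew_mxE.
  rewrite scaleNr -scalerN; congr (_ *: _); rewrite P_skew mulNmx mulNmx opprK.
  have -> : P *m dW r *m P = G^T *m (P *m dW r *m P) *m G.
    by rewrite !mulmxA GtP -!mulmxA PG.
  (* The differentiated relation, rewritten with [G]. Compression by [G^T] and [G] turns each of the
     three terms into plus or minus [G^T dP G], and one copy with a plus sign remains. *)
  have -> : P *m dW r *m P = - dP r + dP r *m G + G^T *m dP r.
    rewrite -dPWP GtE /G mulmxN mulNmx !mulmxA.
    by rewrite addrAC addrK addrAC subrr add0r.
  clearbody G; rewrite !mulmxDr !mulmxDl mulmxN mulNmx.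
  have -> : G^T *m (dP r *m G) *m G = G^T *m dP r *m G.
    by rewrite mulmxA -mulmxA GG.
  by rewrite [G^T *m (G^T *m _)]mulmxA GtGt addNr add0r.
rewrite {2}/cyclic_sum -!projF -/(cyclic_sum _ i j k) -tri_cyclic; apply/esym.
apply: tri_of_slot3 => {i j k} i j k; first by rewrite /cyclic_sum -addrA addrC.
(* The foliated condition enters here. Of the three cyclic terms, one has the last index in [S c],
   already invariant; the other two add up to the bracket of the fields with indices [i] and [j],
   which has the form [z P] and is fixed by [G]. *)
have [z vz] := bracket_in_image i j.
have FE c : cyclic_sum F i j c = S c i j + (z *m P) 0 c.
  rewrite -vz /cyclic_sum -addrA; congr (_ + _); rewrite /F /S !summxE -big_split.
  apply: eq_bigr => l _; rewrite !mxE; congr (_ + _); rewrite -mulrN; congr (_ * _).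
  exact: skew_mxE (dP_skew l).
under eq_bigr do rewrite FE mulrDl.
rewrite FE big_split /=; congr (_ + _).
  rewrite -[in RHS](S_slot k) summxE; apply: eq_bigr => c _.
  by rewrite [RHS]mxE mulrC.
by rewrite -[in RHS]PG mulmxA [RHS]mxE.
Qed.

End TrilinearAlgebra.

(** * Two-forms inverse to the bivector field *)

(** The naturality of [d] under a change of coordinates. [H z] stands for the derivative of the
    Jacobian [J] and [dWa] for that of [J W J^T]; the terms in [H] have the form [K z - (K z)^T],
    and they cancel in the cyclic sum because [K z x y] is symmetric in [z] and [x]. *)
Lemma cyclic_sum_pullback (R : realFieldType) (n : nat)
    (dWa dWb H : 'I_n -> 'M[R]_n) (W J : 'M[R]_n) :
  (forall x z s, H z x s = H x z s) -> W^T = - W ->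
  (forall z, dWa z = (H z *m W + J *m (\sum_r J z r *: dWb r)) *m J^T
                     + J *m W *m (H z)^T) ->
  forall i j k, cyclic_sum (fun x y z => dWa z x y) i j k =
    tri (cyclic_sum (fun x y z => dWb z x y)) J^T i j k.
Proof.
move=> HC W_skew dWaE i j k; pose K z := H z *m (W *m J^T).
have KC x y z : K z x y = K x z y.
  by rewrite !mxE; apply: eq_bigr => s _; rewrite HC.
have E x y z : dWa z x y =
    (\sum_r J^T r z *: (J *m dWb r *m J^T)) x y + (K z x y - K z y x).
  have -> : dWa z = \sum_r J^T r z *: (J *m dWb r *m J^T) + (K z - (K z)^T).
    rewrite dWaE mulmxDl [X in X + _]addrC -addrA; congr (_ + (_ + _)).
    - rewrite mulmx_sumr mulmx_suml; apply: eq_bigr => r _.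
      by rewrite -scalemxAr -scalemxAl [J^T r z]mxE.
    - by rewrite /K mulmxA.
    by rewrite /K trmx_mul trmx_mul trmxK W_skew mulmxN mulNmx opprK.
  have addsubE (A B : 'M[R]_n) : (A + (B - B^T)) x y = A x y + (B x y - B y x).
    by rewrite !mxE.
  exact: addsubE.
rewrite tri_cyclic /cyclic_sum !(tri_mulmx dWb J^T) trmxK.
rewrite !E (KC i j k) (KC j i k) (KC j k i); ring.
Qed.

Section TwoForms.
Context (R : realType) (n : nat) (M : smoothManifold R n).
Local Notation I := (chart_index M).
Implicit Types (a b c : I) (m p : M) (A B : M -> 'M[R]_n) (U : set M).

Definition smooth_mx_at (u v : nat) (A : M -> 'M[R]_(u, v)) m : Prop :=
  forall i j, smooth_at (fun p => A p i j) m.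

Definition pd_mx c l A m : 'M[R]_n := \matrix_(i, j) pd c l (fun p => A p i j) m.

Lemma smooth_mx_at_cst (u v : nat) (A : 'M[R]_(u, v)) m : smooth_mx_at (fun=> A) m.
Proof. by move=> i j; exact: smooth_at_cst. Qed.

Lemma smooth_mx_atM (u v x : nat) (A : M -> 'M[R]_(u, v))
    (B : M -> 'M[R]_(v, x)) m :
  smooth_mx_at A m -> smooth_mx_at B m ->
  smooth_mx_at (fun p => A p *m B p) m.
Proof.
move=> As Bs i j; apply: (@smooth_at_eq _ _ _ (fun p => \sum_k A p i k * B p k j)).
  by apply: near_all => p; rewrite mxE.
by apply: smooth_at_sum => k _; exact: smooth_atM.
Qed.

Lemma smooth_mx_atT (u v : nat) (A : M -> 'M[R]_(u, v)) m :
  smooth_mx_at A m -> smooth_mx_at (fun p => (A p)^T) m.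
Proof.
move=> As i j; apply: smooth_at_eq (As j i).
by apply: near_all => p; rewrite mxE.
Qed.

Lemma smooth_mx_atN (u v : nat) (A : M -> 'M[R]_(u, v)) m :
  smooth_mx_at A m -> smooth_mx_at (fun p => - A p) m.
Proof.
move=> As i j; apply: smooth_at_eq (smooth_atN (As i j)).
by apply: near_all => p; rewrite mxE.
Qed.

Lemma smooth_at_det (u : nat) (A : M -> 'M[R]_u) m :
  smooth_mx_at A m -> smooth_at (fun p => \det (A p)) m.
Proof.
move=> As; apply: smooth_at_sum => s _; apply: smooth_atM.
  exact: smooth_at_cst.
by apply: smooth_at_prod => i _; exact: As.
Qed.

Lemma smooth_mx_at_inv (u : nat) (A : M -> 'M[R]_u) m :
  smooth_mx_at A m -> A m \in unitmx -> smooth_mx_at (fun p => invmx (A p)) m.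
Proof.
move=> As Au i j; have detA := smooth_at_det As.
have det0 : \det (A m) != 0 by rewrite -unitfE -unitmxE.
apply: (@smooth_at_eq _ _ _
  (fun p => (\det (A p))^-1 * ((-1) ^+ (j + i) * \det (row' j (col' i (A p)))))).
  (* [invmx] is the identity function on singular matrices, so Cramer's formula holds only near [m],
     where the determinant stays nonzero. *)
  apply: filterS (smooth_at_neq0 detA det0) => p dp.
  by rewrite /invmx unitmxE unitfE dp !mxE.
apply: smooth_atM; first exact: smooth_at_inv.
apply: smooth_atM; first exact: smooth_at_cst.
apply: smooth_at_det => k l; apply: smooth_at_eq (As (lift j k) (lift i l)).
by apply: near_all => p; rewrite !mxE.
Qed.

Lemma smooth_mx_at_jac a b m : chart_dom a m -> chart_dom b m ->
  smooth_mx_at (jac a b) m.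
Proof. by move=> am bm i j; exact: smooth_at_jac. Qed.

Lemma pd_mx_eq c l A B m : chart_dom c m -> (\forall p \near m, A p = B p) ->
  pd_mx c l A m = pd_mx c l B m.
Proof.
move=> cm AB; apply/matrixP => i j; rewrite !mxE; apply: pd_eq => //.
by apply: filterS AB => p ->.
Qed.

Lemma pd_mxM c l A B m : chart_dom c m -> smooth_mx_at A m -> smooth_mx_at B m ->
  pd_mx c l (fun p => A p *m B p) m = pd_mx c l A m *m B m + A m *m pd_mx c l B m.
Proof.
move=> cm As Bs; apply/matrixP => i j; rewrite !mxE.
rewrite (@pd_eq _ _ _ c l _ (fun p => \sum_k A p i k * B p k j)) //; last first.
  by apply: near_all => p; rewrite mxE.
rewrite pd_sum //; last by move=> k; exact: smooth_atM.
rewrite -big_split; apply: eq_bigr => k _ /=.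
by rewrite pdM // !mxE.
Qed.

Lemma pd_mxN c l A m : chart_dom c m -> smooth_mx_at A m ->
  pd_mx c l (fun p => - A p) m = - pd_mx c l A m.
Proof.
move=> cm As; apply/matrixP => i j; rewrite [LHS]mxE [RHS]mxE [X in - X]mxE -pdN //.
by apply: pd_eq => //; apply: near_all => p; rewrite mxE.
Qed.

Lemma pd_mxT c l A m : pd_mx c l (fun p => (A p)^T) m = (pd_mx c l A m)^T.
Proof.
apply/matrixP => i j; rewrite [LHS]mxE [RHS]mxE [RHS]mxE; congr (pd _ _ _ _).
by apply/funext => p; rewrite mxE.
Qed.

Definition is_form2 U (w : I -> M -> 'M[R]_n) : Prop :=
  [/\ forall c m, U m -> chart_dom c m -> smooth_mx_at (w c) m,
      forall c m, U m -> chart_dom c m -> (w c m)^T = - w c m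
    & forall a b m, U m -> chart_dom a m -> chart_dom b m ->
        w a m = jac a b m *m w b m *m (jac a b m)^T].

(** For skew [w] this is the usual [d_i w_jk - d_j w_ik + d_k w_ij], written cyclically to match the
    shape of the Schouten bracket. *)
Definition ext_d2 (w : I -> M -> 'M[R]_n) : form3_components M :=
  fun c m => cyclic_sum (fun i j k => pd c k (fun p => w c p i j) m).

Section ExteriorDerivative.
Variables (U : set M) (w : I -> M -> 'M[R]_n).
Hypotheses (Uo : open U) (w_form : is_form2 U w).

Let near_U m : U m -> \forall p \near m, U p.
Proof. by move=> Um; exact: open_nbhs_nbhs. Qed.

Lemma form2_smooth c m i j : U m -> chart_dom c m ->
  smooth_at (fun p => w c p i j) m.
Proof. by move=> Um cm; case: w_form => H _ _; exact: H. Qed.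

Lemma pd_form2_skew c m i j k : U m -> chart_dom c m ->
  pd c k (fun p => w c p i j) m = - pd c k (fun p => w c p j i) m.
Proof.
move=> Um cm; rewrite -pdN //; last exact: form2_smooth.
apply: pd_eq => //; apply: filterS2 (near_U Um) (near_chart_dom cm) => p Up cp.
by case: w_form => _ H _; exact: skew_mxE (H c p Up cp).
Qed.

Lemma ext_d2_closed : closed_form3 U (ext_d2 w).
Proof.
have phi_smooth c i j k m : U m -> chart_dom c m ->
    smooth_at (fun p => ext_d2 w c p i j k) m.
  move=> Um cm; have H u v x : smooth_at (pd c x (fun p => w c p u v)) m.
    by apply: smooth_at_pd => //; exact: form2_smooth.
  exact: (smooth_atD (smooth_atD (H i j k) (H j k i)) (H k i j)).
split.
  split.
  - move=> c i j k; apply: chart_smooth_of_smooth_at Uo _ => m Um cm.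
    exact: phi_smooth.
  - move=> c m i j k Um cm; rewrite /ext_d2 /cyclic_sum.
    rewrite (@pd_form2_skew c m j i k) // (@pd_form2_skew c m i k j) //.
    rewrite (@pd_form2_skew c m k j i) //.
    by split; ring.
  move=> a b m i j k Um am bm.
  have [ws wT wJ] := w_form; have Js := smooth_mx_at_jac am bm.
  have wbs : smooth_mx_at (w b) m by exact: ws.
  have pd_w z : pd_mx a z (w a) m =
      (pd_mx a z (jac a b) m *m w b m +
       jac a b m *m (\sum_r jac a b m z r *: pd_mx b r (w b) m)) *m (jac a b m)^T
      + jac a b m *m w b m *m (pd_mx a z (jac a b) m)^T.
    have -> : pd_mx a z (w a) m =
        pd_mx a z (fun p => jac a b p *m w b p *m (jac a b p)^T) m.
      apply: pd_mx_eq => //; have nb := near_chart_dom bm.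
      apply: filterS3 (near_U Um) (near_chart_dom am) nb => p Up ap bp.
      exact: wJ.
    rewrite pd_mxM //; last 2 first.
    - exact: smooth_mx_atM.
    - exact: smooth_mx_atT.
    rewrite pd_mxM // pd_mxT.
    have -> // : pd_mx a z (w b) m = \sum_r jac a b m z r *: pd_mx b r (w b) m.
    apply/matrixP => x y; rewrite summxE [LHS]mxE (pd_chain z am bm (wbs x y)).
    by apply: eq_bigr => r _; rewrite [RHS]mxE [X in _ = _ * X]mxE.
  have ext_dE c : ext_d2 w c m = cyclic_sum (fun x y z => pd_mx c z (w c) m x y).
    by rewrite /ext_d2; congr cyclic_sum; apply/funext => x; apply/funext => y;
      apply/funext => z; rewrite [RHS]mxE.
  transitivity (tri (ext_d2 w b m) (jac a b m)^T i j k); last first.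
    apply: eq_bigr => x _; apply: eq_bigr => y _; apply: eq_bigr => z _.
    rewrite [_^T x i]mxE [_^T y j]mxE [_^T z k]mxE; ring.
  rewrite !ext_dE; apply: cyclic_sum_pullback (wT b m Um bm) pd_w i j k => x z s.
  by rewrite [LHS]mxE [RHS]mxE; exact: pd_jacC.
move=> c m i j k l Um cm; rewrite /ext_d3 /ext_d2 /cyclic_sum.
pose D x y u v := pd c x (pd c y (fun p => w c p u v)) m.
have ws u v : smooth_at (fun p => w c p u v) m by exact: form2_smooth.
have pws y u v : smooth_at (pd c y (fun p => w c p u v)) m by exact: smooth_at_pd.
have pd_phi x u v z : pd c x (fun p => pd c z (fun p => w c p u v) p +
    pd c u (fun p => w c p v z) p + pd c v (fun p => w c p z u) p) m =
    D x z u v + D x u v z + D x v z u.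
  rewrite (pdD x cm (smooth_atD (pws z u v) (pws u v z)) (pws v z u)).
  by rewrite (pdD x cm (pws z u v) (pws u v z)).
have Dsym x y u v : D x y u v = D y x u v by exact: pdC.
have Dskew x y u v : D x y u v = - D x y v u.
  rewrite /D -pdN //; apply: pd_eq => //.
  apply: filterS2 (near_U Um) (near_chart_dom cm) => p Up cp.
  exact: pd_form2_skew.
(* Twelve second derivatives remain, which cancel in pairs; the rewrites give both members of each
   pair the same order of indices. *)
rewrite !pd_phi; move: (D) Dsym Dskew => E Esym Eskew.
rewrite (Esym l i j k) (Esym j i k l) (Eskew k i j l) (Esym k i l j).
rewrite (Eskew l j k i) (Esym l j i k) (Esym k j l i) (Esym l k i j); ring.
Qed.

End ExteriorDerivative.

End TwoForms.

(** * From an inverse 2-form to a twisted Poisson structure *)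

Section TwistedFromForm.
Context (R : realType) (n : nat) (M : smoothManifold R n).
Local Notation I := (chart_index M).
Variable pi : bivector_components M.
Hypotheses (pi_bivector : is_bivector setT pi) (pi_foliated : foliated pi).

Lemma bivector_skew c m : chart_dom c m -> (pi c m)^T = - pi c m.
Proof. by case: pi_bivector => _ H _ cm; exact: H. Qed.

Lemma bivectorJ a b m : chart_dom a m -> chart_dom b m ->
  pi b m = (jac a b m)^T *m pi a m *m jac a b m.
Proof. by case: pi_bivector => _ _ H am bm; exact: H. Qed.

Lemma smooth_mx_at_bivector c m : chart_dom c m -> smooth_mx_at (pi c) m.
Proof. by move=> cm i j; exact: smooth_at_bivector. Qed.

(** Reduces to [half_schouten_eq] at each point of each chart. Since [U] is open, [pi w pi = - pi]
    holds near the point and may be differentiated. *)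
Lemma twisted_poisson_ext_d2 (U : set M) (w : I -> M -> 'M[R]_n) :
  open U -> is_form2 U w ->
  (forall c m, U m -> chart_dom c m -> pi c m *m w c m *m pi c m = - pi c m) ->
  twisted_poisson U pi (ext_d2 w).
Proof.
move=> Uo w_form PWP; split; [|exact: ext_d2_closed|].
  split.
  - move=> c i j; apply: chart_smooth_of_smooth_at Uo _ => m _ cm.
    exact: smooth_at_bivector.
  - by move=> c m _; exact: bivector_skew.
  - by move=> a b m _; exact: bivectorJ.
move=> c m i j k Um cm.
have [ws wT _] := w_form; have Ps := smooth_mx_at_bivector cm.
have Ws := ws c m Um cm.
have dskew l : (pd_mx c l (pi c) m)^T = - pd_mx c l (pi c) m.
  rewrite -pd_mxT -pd_mxN //; apply: pd_mx_eq => //.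
  by apply: filterS (near_chart_dom cm) => p; exact: bivector_skew.
have dPWP l : pd_mx c l (pi c) m *m w c m *m pi c m +
    pi c m *m pd_mx c l (w c) m *m pi c m +
    pi c m *m w c m *m pd_mx c l (pi c) m = - pd_mx c l (pi c) m.
  rewrite -mulmxDl -pd_mxM // -pd_mxN //.
  rewrite -(pd_mxM l cm (smooth_mx_atM Ps Ws) Ps); apply: pd_mx_eq => //.
  have nU : \forall p \near m, U p by exact: open_nbhs_nbhs.
  by apply: filterS2 nU (near_chart_dom cm) => p; exact: PWP.
have bracket i0 j0 : exists z : 'rV[R]_n, forall k0,
    \sum_l (pi c m i0 l * pd_mx c l (pi c) m j0 k0 -
            pi c m j0 l * pd_mx c l (pi c) m i0 k0) = (z *m pi c m) 0 k0.
  have [z zE] := foliated_bracket pi_bivector pi_foliated i0 j0 cm.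
  exists z => k0; rewrite -zE; apply: eq_bigr => l _.
  by rewrite [pd_mx _ _ _ _ j0 k0]mxE [pd_mx _ _ _ _ i0 k0]mxE.
have := half_schouten_eq (bivector_skew cm) dskew (wT c m Um cm)
  (PWP c m Um cm) dPWP bracket i j k.
have -> : cyclic_sum (fun p q r => pd_mx c r (w c) m p q) = ext_d2 w c m.
  by rewrite /ext_d2; congr cyclic_sum; apply/funext => x; apply/funext => y;
    apply/funext => z; rewrite [LHS]mxE.
rewrite -[wedge3_sharp _ _ _ _ _ _ _]/(tri (ext_d2 w c m) (pi c m) i j k) => <-.
rewrite /schouten /cyclic_sum.
(* The two summands of [schouten] coincide for equal arguments, which yields the 2 cancelled by the
   factor [2^-1]. *)
have E x y z : \sum_l (pi c m z l * pd c l (fun p => pi c p x y) m +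
    pi c m z l * pd c l (fun p => pi c p x y) m) =
    2 * \sum_l pi c m z l * pd_mx c l (pi c) m x y.
  rewrite mulr_sumr; apply: eq_bigr => l _.
  by rewrite [pd_mx _ _ _ _ x y]mxE -mulr2n mulr_natl.
by rewrite !E -!mulrDr mulrA mulVf ?mul1r // pnatr_eq0.
Qed.

End TwistedFromForm.

(** * Generalized inverses of skew matrices *)

Section SkewInverse.
Context (R : realFieldType) (n : nat).

(** Write [P = C B] with [C] and [B] of full rank and take [E C = 1], so [E P = B]. Skewness gives
    [- B^T = P E^T = C (B E^T)], so [B E^T = E P E^T] has at least the rank of [B]. For a nilpotent
    [P] the same compression can vanish. *)
Lemma exists_compression (P : 'M[R]_n) : P^T = - P ->
  exists E : 'M[R]_(\rank P, n), E *m P *m E^T \in unitmx.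
Proof.
move=> P_skew; have /row_fullP[E EC] := col_base_full P; exists E.
have EP : E *m P = row_base P.
  by have := congr1 (mulmx E) (mulmx_base P); rewrite mulmxA EC mul1mx => <-.
rewrite -row_free_unit -row_leq_rank EP.
have rkE : \rank (row_base P)^T = \rank P.
  by rewrite mxrank_tr; apply/eqP; exact: row_base_free.
rewrite -{1}rkE -(mxrank_opp (row_base P)^T).
have -> : - (row_base P)^T = col_base P *m (row_base P *m E^T).
  by rewrite mulmxA mulmx_base -EP trmx_mul P_skew mulNmx opprK.
exact: mxrankM_maxr.
Qed.

Variables (r : nat) (P : 'M[R]_n) (E : 'M[R]_(r, n)).
Hypotheses (P_skew : P^T = - P) (rkP : \rank P = r)
  (F_unit : E *m P *m E^T \in unitmx).

(** This is where constancy of the rank is used. Invertibility of [E P E^T] gives [E P] rank [r],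
    the rank of [P], so [P = A E P] for some [A]; multiplying by [E^T] on the right determines
    [A]. *)
Lemma compression_inverse :
  P *m - (E^T *m invmx (E *m P *m E^T) *m E) *m P = - P.
Proof.
have sub : (P <= E *m P)%MS.
  have [_] := mxrank_leqif_sup (submxMl E P); rewrite eqn_leq mxrankM_maxr /=.
  move=> <-; rewrite rkP -{1}(mxrank_unit F_unit); exact: mxrankM_maxl.
have /submxP[A PA] := sub.
have AE : A = P *m E^T *m invmx (E *m P *m E^T).
  by rewrite {1}PA -[A *m _ *m _]mulmxA mulmxK.
by rewrite mulmxN mulNmx; congr (- _); rewrite [RHS]PA AE !mulmxA.
Qed.

Lemma compression_skew :
  (- (E^T *m invmx (E *m P *m E^T) *m E))^T = E^T *m invmx (E *m P *m E^T) *m E.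
Proof.
set F := E *m P *m E^T.
have FT : F^T = -1 *: F.
  by rewrite /F !trmx_mul trmxK P_skew mulNmx mulmxN mulmxA scaleN1r.
rewrite linearN /= !trmx_mul trmxK trmx_inv FT invmxZ; last first.
  by rewrite -FT unitmx_tr.
by rewrite invrN1 scaleN1r mulNmx mulmxN opprK mulmxA.
Qed.

End SkewInverse.

(** * Local solutions near a regular point *)

Section LocalForm.
Context (R : realType) (n : nat) (M : smoothManifold R n).
Local Notation I := (chart_index M).
Variable pi : bivector_components M.
Hypotheses (pi_bivector : is_bivector setT pi).

(* [th] is [f] times a local solution [w] of [pi w pi = - pi].  All these
   conditions are linear in the pair [(f, th)], and they make sense globally. *)
Definition weighted_form2 (f : M -> R) (th : I -> M -> 'M[R]_n) : Prop :=
  [/\ forall p, smooth_at f p, forall p, 0 <= f p, is_form2 setT th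
    & forall c p, chart_dom c p -> pi c p *m th c p *m pi c p = - f p *: pi c p].

Lemma weighted_form2_local m : regular pi m ->
  exists f th, weighted_form2 f th /\ 0 < f m.
Proof.
move=> [r rk_near]; have [c cm] := chart_cover m.
have rk_m : \rank (pi c m) = r by exact: nbhs_singleton rk_near _ cm.
have [E] := exists_compression (bivector_skew pi_bivector cm).
(* [E] is chosen at [m] and then kept constant. Its number of rows is rewritten to [r], so that the
   type no longer refers to the point [m]. *)
rewrite -/(\rank (pi c m)) => E_unit; move: E E_unit; rewrite rk_m => E E_unit.
pose F p := E *m pi c p *m E^T.
have F_smooth p : chart_dom c p -> smooth_mx_at F p.
  move=> cp; apply: smooth_mx_atM; last exact: smooth_mx_at_cst.
  by apply: smooth_mx_atM; [exact: smooth_mx_at_cst|exact: smooth_mx_at_bivector].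
pose Q p := [/\ chart_dom c p, \rank (pi c p) = r & F p \in unitmx].
pose W := interior [set p | Q p].
have WQ p : W p -> Q p by move=> /interior_subset.
have Wm : W m.
  have nF : \forall p \near m, \det (F p) != 0.
    apply: (smooth_at_neq0 (smooth_at_det (F_smooth m cm))).
    by rewrite -unitfE -unitmxE.
  apply: filterS3 (near_chart_dom cm) rk_near nF => p cp rkp Fp; split => //.
    exact: rkp.
  by rewrite unitmxE unitfE.
have [f fb fm] := exists_bump (open_interior _) Wm; have [fs f0 _] := fb.
pose w p := - (E^T *m invmx (F p) *m E).
have w_smooth p : W p -> smooth_mx_at w p.
  move=> /WQ[cp _ Fp]; apply: smooth_mx_atN.
  apply: smooth_mx_atM; last exact: smooth_mx_at_cst.
  apply: smooth_mx_atM; first exact: smooth_mx_at_cst.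
  by apply: smooth_mx_at_inv => //; exact: F_smooth.
have w_skew p : W p -> (w p)^T = - w p.
  move=> /WQ[cp _ Fp]; rewrite /w opprK.
  by rewrite compression_skew // bivector_skew.
have PwP p : W p -> pi c p *m w p *m pi c p = - pi c p.
  by move=> /WQ[cp rkp Fp]; exact: compression_inverse.
(* The pullback of [w] from the chart [c] to the chart [b]. Where [p] lies outside the domain of [c]
   the Jacobian is meaningless, but there [f] vanishes. *)
pose th b p := f p *: (jac b c p *m w p *m (jac b c p)^T).
have th0 b p : ~ W p -> th b p = 0.
  by move=> Wp; rewrite /th (bump_on_eq0 fb Wp) scale0r.
exists f, th; split => //; split => //.
  split.
  - move=> b p _ bp i j.
    apply: (@smooth_at_eq _ _ _
      (fun q => f q * (jac b c q *m w q *m (jac b c q)^T) i j)).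
      by apply: near_all => q; rewrite /th [RHS]mxE.
    apply: smooth_at_bumpM fb _ => Wp; have [cp _ _] := WQ _ Wp.
    have Js := smooth_mx_at_jac bp cp.
    apply: smooth_mx_atM; last exact: smooth_mx_atT.
    by apply: smooth_mx_atM => //; exact: w_smooth.
  - move=> b p _ bp; have [Wp|Wp] := EM (W p); last by rewrite !th0 // trmx0 oppr0.
    rewrite /th linearZ /= !trmx_mul trmxK w_skew // mulNmx mulmxN scalerN.
    by rewrite mulmxA.
  - move=> a b p _ ap bp; have [Wp|Wp] := EM (W p); last first.
      by rewrite !th0 // mulmx0 mul0mx.
    have [cp _ _] := WQ _ Wp.
    rewrite /th (jac_comp ap bp cp) -scalemxAr -scalemxAl trmx_mul.
    by rewrite !mulmxA.
move=> b p bp; have [Wp|Wp] := EM (W p); last first.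
  by rewrite th0 // mulmx0 mul0mx (bump_on_eq0 fb Wp) oppr0 scale0r.
have [cp _ _] := WQ _ Wp.
have JJ : jac c b p *m jac b c p = 1%:M by rewrite -jac_comp // jac_id.
have JJT : (jac b c p)^T *m (jac c b p)^T = 1%:M by rewrite -trmx_mul JJ trmx1.
rewrite (bivectorJ pi_bivector cp bp) /th -scalemxAr -scalemxAl scaleNr -scalerN.
congr (_ *: _); rewrite -mulNmx -mulmxN -(PwP p Wp) !mulmxA.
rewrite -[_ *m jac c b p *m jac b c p]mulmxA JJ mulmx1.
by rewrite -[_ *m (jac b c p)^T *m (jac c b p)^T]mulmxA JJT mulmx1.
Qed.

End LocalForm.

(** * Gluing the local solutions over the regular points *)

Section Gluing.
Context (R : realType) (n : nat) (M : smoothManifold R n).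
Local Notation I := (chart_index M).
Variable pi : bivector_components M.
Hypotheses (pi_bivector : is_bivector setT pi).
Implicit Types (f g : M -> R) (th : I -> M -> 'M[R]_n).

Lemma weighted_form2_0 : weighted_form2 pi (fun=> 0) (fun _ _ => 0).
Proof.
split => //=; first by move=> p; exact: smooth_at_cst.
  split=> [c p _ _|c p _ _|a b p _ _ _]; last 2 first.
  - by rewrite trmx0 oppr0.
  - by rewrite mulmx0 mul0mx.
  exact: smooth_mx_at_cst.
by move=> c p _; rewrite mulmx0 mul0mx oppr0 scale0r.
Qed.

Lemma weighted_form2D f g th th' :
  weighted_form2 pi f th -> weighted_form2 pi g th' ->
  weighted_form2 pi (fun p => f p + g p) (fun c p => th c p + th' c p).
Proof.
move=> [fs f0 [ts tT tJ] Pt] [gs g0 [ts' tT' tJ'] Pt']; split.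
- by move=> p; exact: smooth_atD.
- by move=> p; rewrite addr_ge0.
- split.
  + move=> c p _ cp i j.
    apply: (@smooth_at_eq _ _ _ (fun q => th c q i j + th' c q i j)).
      by apply: near_all => q; rewrite mxE.
    by apply: smooth_atD; [exact: ts|exact: ts'].
  + by move=> c p _ cp; rewrite linearD /= tT // tT' // opprD.
  + by move=> a b p _ ap bp; rewrite mulmxDr mulmxDl -tJ // -tJ'.
by move=> c p cp; rewrite mulmxDr mulmxDl Pt // Pt' // opprD scalerDl.
Qed.

Lemma weighted_form2M f g th :
  (forall p, smooth_at g p) -> (forall p, 0 <= g p) -> weighted_form2 pi f th ->
  weighted_form2 pi (fun p => g p * f p) (fun c p => g p *: th c p).
Proof.
move=> gs g0 [fs f0 [ts tT tJ] Pt]; split.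
- by move=> p; exact: smooth_atM.
- by move=> p; rewrite mulr_ge0.
- split.
  + move=> c p _ cp i j.
    apply: (@smooth_at_eq _ _ _ (fun q => g q * th c q i j)).
      by apply: near_all => q; rewrite mxE.
    by apply: smooth_atM => //; exact: ts.
  + by move=> c p _ cp; rewrite linearZ /= tT // scalerN.
  + by move=> a b p _ ap bp; rewrite -scalemxAr -scalemxAl -tJ.
by move=> c p cp; rewrite -scalemxAr -scalemxAl Pt // scalerA mulrN.
Qed.

Lemma weighted_form2_sum (f_ : nat -> M -> R) (th_ : nat -> I -> M -> 'M[R]_n) N :
  (forall k, weighted_form2 pi (f_ k) (th_ k)) ->
  weighted_form2 pi (fun p => \sum_(k < N) f_ k p)
                    (fun c p => \sum_(k < N) th_ k c p).
Proof.
move=> H; elim: N => [|N IH].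
  have := weighted_form2_0; congr (weighted_form2 pi _ _).
    by apply/funext => p; rewrite big_ord0.
  by apply/funext => c; apply/funext => p; rewrite big_ord0.
have := weighted_form2D IH (H N).
congr (weighted_form2 pi _ _).
  by apply/funext => p; rewrite big_ord_recr.
by apply/funext => c; apply/funext => p; rewrite big_ord_recr.
Qed.

(** A Lindelöf argument: each regular point has a basic open neighborhood on which the weight of
    some pair is positive, and one such pair is chosen for each basic set admitting one. Indices
    that encode no such set receive the zero pair. *)
Lemma countable_weighted_form2 :
  exists (f_ : nat -> M -> R) (th_ : nat -> I -> M -> 'M[R]_n),
    (forall k, weighted_form2 pi (f_ k) (th_ k)) /\
    (forall m, regular pi m -> exists k, 0 < f_ k m).
Proof.
have [B /countable_injP[g g_inj] [_ B_basis]] := manifold_second_countable M.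
pose good (b : set M) (ft : (M -> R) * (I -> M -> 'M[R]_n)) :=
  weighted_form2 pi ft.1 ft.2 /\ b `<=` [set p | 0 < ft.1 p].
have ex k : exists ft : (M -> R) * (I -> M -> 'M[R]_n), weighted_form2 pi ft.1 ft.2 /\
    forall b, B b -> g b = k -> (exists ft', good b ft') -> good b ft.
  have [[b [Bb gb [ft ftb]]]|no] :=
      EM (exists b, [/\ B b, g b = k & exists ft, good b ft]).
    exists ft; split; first by case: ftb.
    move=> b' Bb' gb' _; rewrite (_ : b' = b) //.
    by apply: g_inj; rewrite ?inE // gb gb'.
  exists (fun=> 0, fun _ _ => 0); split; first exact: weighted_form2_0.
  by move=> b Bb gb ftb; case: no; exists b.
have [ft_ ftP] := choice ex.
exists (fun k => (ft_ k).1), (fun k => (ft_ k).2); split=> [k|m mreg].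
  by case: (ftP k).
have [f [th [fth fm]]] := weighted_form2_local pi_bivector mreg.
have [fs _ _ _] := fth.
have [b [Bb bm] bf] := B_basis m _ (smooth_at_gt (fs m) fm).
exists (g b); have [_ /(_ b Bb erefl)] := ftP (g b).
case; first by exists (f, th).
by move=> _; exact.
Qed.

Lemma sum_ord_stable (V : zmodType) (u : nat -> V) a b :
  (forall k, (a <= k)%N -> u k = 0) -> (forall k, (b <= k)%N -> u k = 0) ->
  \sum_(k < a) u k = \sum_(k < b) u k.
Proof.
wlog ab : a b / (a <= b)%N.
  by move=> H ua ub; case/orP: (leq_total a b) => ab; [|symmetry]; exact: H.
move=> ua _; rewrite -!(big_mkord xpredT u) (@big_cat_nat _ _ _ a 0 b) //=.
by rewrite [X in _ + X]big_nat_cond [X in _ + X]big1 ?addr0 // => k /andP[/andP[/ua]].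
Qed.

Lemma regular_open : open (regular pi).
Proof.
rewrite openE => m [r]; rewrite -near_nbhs => /near_join H; rewrite /interior.
by apply: filterS H => p Hp; exists r.
Qed.

(** The weights are not normalized beforehand: the pairs are summed, and the relation
    [pi Th pi = - F pi] is divided by the total weight [F]. Sums are cut at a bound [N m] depending
    on the point, so no series occurs. *)
Lemma exists_inverse_form2 : exists w : I -> M -> 'M[R]_n,
  is_form2 (regular pi) w /\
  forall c m, regular pi m -> chart_dom c m ->
    pi c m *m w c m *m pi c m = - pi c m.
Proof.
have [f_ [th_ [fth f_pos]]] := countable_weighted_form2.
have f_ge0 k p : 0 <= f_ k p by case: (fth k).
have f_smooth k p : smooth_at (f_ k) p by case: (fth k).
(* [eta k] vanishes where some earlier [f_ j] exceeds [1 / (k + 1)]; this makes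
   the supports locally finite without any use of compactness. *)
pose eta k p : R := \prod_(j < k) flat 0 (k.+1%:R^-1 - f_ j p).
have eta_smooth k p : smooth_at (eta k) p.
  apply: smooth_at_prod => j _; apply: smooth_at_flat.
  by apply: smooth_atD; [exact: smooth_at_cst|exact: smooth_atN].
have eta_ge0 k p : 0 <= eta k p by apply: prodr_ge0 => j _; exact: flat_ge0.
have W k := weighted_form2M (eta_smooth k) (eta_ge0 k) (fth k).
have fin m : exists N, regular pi m ->
    \forall p \near m, forall k, (N <= k)%N -> eta k p = 0.
  have [mreg|] := EM (regular pi m); last by exists 0%N.
  have [j fj] := f_pos m mreg.
  have [d d_lt] := ltr_add_invr fj; rewrite add0r in d_lt.
  (* [f_ j] exceeds [1 / (d + 1)] near [m]. For [k > j] the factor of index [j] occurs in [eta k],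
     and for [k >= d] its argument is at most 0. *)
  exists (maxn j.+1 d) => _; apply: filterS (smooth_at_gt (f_smooth j m) d_lt) => p dp k.
  rewrite geq_max => /andP[jk dk].
  rewrite /eta (bigD1 (Ordinal jk)) //= flat_le0 ?mul0r // subr_le0.
  by rewrite (le_trans _ (ltW dp)) // lef_pV2 ?posrE // ler_nat.
have [N NP] := choice fin.
have Nm m : regular pi m -> forall k, (N m <= k)%N -> eta k m = 0.
  by move=> /NP/nbhs_singleton.
pose Fs K p : R := \sum_(k < K) (eta k p * f_ k p).
pose Th K c p : 'M[R]_n := \sum_(k < K) (eta k p *: th_ k c p).
have WK K : weighted_form2 pi (Fs K) (Th K) by exact: (weighted_form2_sum K W).
(* [N] need not be locally constant. Near [m], however, the terms beyond either bound vanish, so the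
   sums agree with those cut at the fixed [N m], which are smooth. *)
have stable m : regular pi m -> \forall p \near m,
    Fs (N p) p = Fs (N m) p /\
    forall c, Th (N p) c p = Th (N m) c p.
  move=> mreg; have nreg := open_nbhs_nbhs (conj regular_open mreg).
  apply: filterS2 nreg (NP m mreg) => p preg Nk; split=> [|c].
    apply: (@sum_ord_stable _ (fun k => eta k p * f_ k p)) => k kN.
      by rewrite (Nm p) ?mul0r.
    by rewrite Nk ?mul0r.
  apply: (@sum_ord_stable _ (fun k => eta k p *: th_ k c p)) => k kN.
    by rewrite (Nm p) ?scale0r.
  by rewrite Nk ?scale0r.
have F_pos m : regular pi m -> 0 < Fs (N m) m.
  move=> mreg; have [k0 fk0] := f_pos m mreg.
  have ex : exists k, 0 < f_ k m by exists k0.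
  (* For the least [k] with [f_ k m] positive, all earlier [f_ j m] are at most 0, so every factor
     of [eta k m] is positive. *)
  case: (ex_minnP ex) => k fk kmin.
  have ek : 0 < eta k m.
    apply: prodr_gt0 => j _; apply: flat_gt0; rewrite subr_gt0.
    have [fj|] := ltP 0 (f_ j m); first by have := kmin _ fj; rewrite leqNgt ltn_ord.
    by move=> fj; rewrite (le_lt_trans fj) // invr_gt0.
  have kN : (k < N m)%N.
    by rewrite ltnNge; apply/negP => /(Nm m mreg) e0; rewrite e0 ltxx in ek.
  rewrite /Fs (bigD1 (Ordinal kN)) //= ltr_pwDl ?mulr_gt0 //.
  by apply: sumr_ge0 => i _; rewrite mulr_ge0.
exists (fun c m => (Fs (N m) m)^-1 *: Th (N m) c m); split; first split.
- move=> c m mreg cm i j.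
  apply: (@smooth_at_eq _ _ _ (fun p => (Fs (N m) p)^-1 * Th (N m) c p i j)).
    by apply: filterS (stable m mreg) => p [E1 E2]; rewrite mxE E1 E2.
  have [Fsm _ [Thm _ _] _] := WK (N m).
  apply: smooth_atM; last exact: Thm.
  by apply: smooth_at_inv => //; rewrite gt_eqF ?F_pos.
- move=> c m _ cm; have [_ _ [_ TT _] _] := WK (N m).
  by rewrite linearZ /= TT // scalerN.
- move=> a b m _ am bm; have [_ _ [_ _ TJ] _] := WK (N m).
  by rewrite -scalemxAr -scalemxAl -TJ.
move=> c m mreg cm; have [_ _ _ PT] := WK (N m).
rewrite -scalemxAr -scalemxAl PT // scaleNr scalerN scalerA mulVf ?scale1r //.
by rewrite gt_eqF ?F_pos.
Qed.

End Gluing.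

Theorem proposition4 (R : realType) (n : nat) (M : smoothManifold R n)
    (pi : bivector_components M) (pi_bivector : is_bivector setT pi)
    (pi_foliated : foliated pi) :
  (forall m : M, regular pi m ->
     exists (U : set M) (phi : form3_components M),
       open U /\ U m /\ twisted_poisson U pi phi) /\
  (forall o : chart_index M -> M -> bool, is_orientation o ->
     exists phi : form3_components M, twisted_poisson (regular pi) pi phi).
Proof.
have reg_open := regular_open pi.
have [w [w_form PwP]] := exists_inverse_form2 pi_bivector.
have twisted := twisted_poisson_ext_d2 pi_bivector pi_foliated reg_open w_form PwP.
split=> [m mreg|o _]; last by exists (ext_d2 w).
by exists (regular pi), (ext_d2 w).
Qed.
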